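(* Let $T\ge1$ be an integer. In the stochastic OLO setting, against all adversaries $\mathbb{P}$, the Stein algorithm given any convex and $1$-Lipschitz function $h:\mathbb{R}\to\mathbb{R}$ (and run with any admissible parameter process $(P_t)_{t=0}^T$) guarantees $$\mathbb{E}\Big[\sum_{t=1}^TG_tX_t\Big]\le-\mathbb{E}\Big[\mathbb{E}_Z\Big[h\Big(\sum_{t=1}^TG_t+P_TZ\Big)\Big]\Big]+\mathbb{E}_Z[h(P_0Z)]+\mathbb{E}\sum_{t=1}^T\left(\sqrt{\frac2\pi}\,\frac{\max\{\mathbb{E}[G_t^2\mid\mathcal{F}_{t-1}]-C_t,0\}}{P_{t-1}}+\frac{2C_t|G_t|+|G_t^3|}{P_{t-1}^2}\right).$$
   Context: Stochastic OLO (online linear optimization) setting: let $\Omega=\mathbb{R}^T$ with its Borel $\sigma$-algebra $\mathcal{F}$, $G_t(\omega)=\omega_t$ the coordinate process (loss process), $\mathcal{F}_t=\sigma(G_1,\dots,G_t)$ for $t=0,\dots,T$. An adversary is a probability measure $\mathbb{P}$ on $(\Omega,\mathcal{F})$, which may depend arbitrarily on $T$ and on the algorithm; $\mathbb{E}$ is expectation under $\mathbb{P}$, while $\mathbb{E}_Z$ is expectation only over an external $Z\sim\mathcal{N}(0,1)$. An algorithm produces a predictable process $(X_t)_{t=1}^T$ with values in $[-1,1]$: $X_t$ is a Borel function of $G_1,\dots,G_{t-1}$. The total loss is $\sum_{t=1}^TG_tX_t$. Stein equation solution: for a convex and $1$-Lipschitz $h:\mathbb{R}\to\mathbb{R}$,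 $\mu\in\mathbb{R}$, $\sigma>0$, let $f_{\mu,\sigma,h}:\mathbb{R}\to\mathbb{R}$ be the unique bounded solution of $\sigma^2f'(x)-(x-\mu)f(x)=h(x)-\mathbb{E}_{Z}[h(\mu+\sigma Z)]$ for all $x\in\mathbb{R}$. Admissible parameter process: $P_0>0$ is a constant; for $t\ge1$, $P_t$ is $\mathcal{F}_{t-1}$-measurable with $P_t\in[0,P_{t-1}]$ pointwise, and $P_t>0$ pointwise whenever $t<T$. Put $C_t=P_{t-1}^2-P_t^2$, $S_0=0$ and $S_t=\sum_{i=1}^tG_i$. The Stein algorithm with input $h$ outputs $X_t=\mathbb{E}_Z[f_{S_{t-1},P_{t-1},h}(S_{t-1}+P_tZ)]$ for $t=1,\dots,T$. *)

(* Defs.v *)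
From HB Require Import structures.
From mathcomp Require Import all_boot all_order all_algebra.
From mathcomp Require Import all_classical all_reals all_analysis.
From mathcomp Require Import measurable_realfun.
Import Order.TTheory GRing.Theory Num.Theory.
Import numFieldNormedType.Exports.

Set Implicit Arguments.
Unset Strict Implicit.
Unset Printing Implicit Defensive.

Local Open Scope classical_set_scope.
Local Open Scope ring_scope.

(* R^T; the product sigma-algebra carried by tuples is the Borel one since R is
   second countable. *)
Notation loss_space R T := (T.-tuple (measurableTypeR R)).

(* Indices are shifted: the round t = 1, ..., T is i = t - 1 : 'I_T, so that
   loss i is G_t, whereas partial_sum, filtration and parameter processes keep
   their original index in {0, ..., T}, e.g. S_{t-1} is partial_sum i and
   S_t is partial_sum i.+1. *)
Definition loss (R : realType) (T : nat) (i : 'I_T) (w : loss_space R T) : R :=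
  tnth w i.

Definition partial_sum (R : realType) (T k : nat) (w : loss_space R T) : R :=
  \sum_(i < T | (i < k)%N) loss i w.

(* generators of the sigma-algebra F_k = sigma(G_1, ..., G_k) *)
Definition filtration_gen (R : realType) (T k : nat) :
    set (set (loss_space R T)) :=
  \bigcup_(i in [set i : 'I_T | (i < k)%N])
    preimage_set_system [set: loss_space R T] (@loss R T i) measurable.

Definition sub_measurable_fun d (Omega : measurableType d)
    (G : set (set Omega)) d' (U : measurableType d') (f : Omega -> U) : Prop :=
  measurable_fun [set: g_sigma_algebraType G]
                 (f : g_sigma_algebraType G -> U).

(* V is a version of the conditional expectation, given the sigma-algebra
   generated by G, of the nonnegative, possibly non-integrable, Y. *)
Definition is_cond_expectation (R : realType) d (Omega : measurableType d)
    (P : probability Omega R) (G : set (set Omega)) (Y : Omega -> R)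
    (V : Omega -> \bar R) : Prop :=
  sub_measurable_fun G V /\
  forall A, <<s G>> A ->
    (\int[P]_(w in A) V w = \int[P]_(w in A) (Y w)%:E)%E.

Definition gaussian_expectation (R : realType) (g : R -> R) : R :=
  \int[normal_prob (0 : R) 1]_z g z.

Definition is_stein_solution (R : realType) (mu sigma : R) (h f : R -> R) :
    Prop :=
  bounded_fun f /\
  forall x : R, derivable f x 1 /\
    sigma ^+ 2 * 'D_1 f x - (x - mu) * f x =
    h x - gaussian_expectation (fun z => h (mu + sigma * z)).

(* the default value is irrelevant: for h 1-Lipschitz and sigma > 0 there is
   exactly one such f *)
Definition stein_solution (R : realType) (mu sigma : R) (h : R -> R) : R -> R :=
  xget (fun=> 0) [set f | is_stein_solution mu sigma h f].

Definition admissible (R : realType) (T : nat) (p0 : R)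
    (p : nat -> loss_space R T -> R) : Prop :=
  [/\ 0 < p0,
      forall w, p 0%N w = p0
    & forall i : 'I_T,
      [/\ sub_measurable_fun (@filtration_gen R T i) (p i.+1),
          forall w, 0 <= p i.+1 w <= p i w
        & (i.+1 < T)%N -> forall w, 0 < p i.+1 w]].

(* C_t for t = i + 1 *)
Definition variance_budget (R : realType) (T : nat)
    (p : nat -> loss_space R T -> R) (i : nat) (w : loss_space R T) : R :=
  p i w ^+ 2 - p i.+1 w ^+ 2.

(* X_t for t = i + 1 *)
Definition stein_algorithm (R : realType) (T : nat) (h : R -> R)
    (p : nat -> loss_space R T -> R) (i : nat) (w : loss_space R T) : R :=
  gaussian_expectation (fun z =>
    stein_solution (partial_sum i w) (p i w) h
      (partial_sum i w + p i.+1 w * z)).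

(* The summand of the error term for t = i + 1, where V stands for the
   conditional expectation of G_t ^ 2. *)
Definition stein_error (R : realType) (T : nat)
    (p : nat -> loss_space R T -> R) (V : 'I_T -> loss_space R T -> \bar R)
    (i : 'I_T) (w : loss_space R T) : \bar R :=
  ((Num.sqrt (2 / pi))%:E *
     (maxe (V i w - (variance_budget p i w)%:E) 0 * ((p i w)^-1)%:E) +
   ((2 * variance_budget p i w * `|loss i w| + `|loss i w ^+ 3|)
      / p i w ^+ 2)%:E)%E.

(* Main.v *)
(* Let H(s, tau) = E_Z h(s + tau Z), and let f be the solution of Stein's equation
   with parameters S_{t-1} and sigma = P_{t-1}.  Evaluating the equation at
   S_{t-1} + G_t + P_t Z and integrating the term Z f by parts gives
     H(S_t, P_t) - H(S_{t-1}, P_{t-1}) =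
       C_t E_Z f'(S_t + P_t Z) - G_t E_Z f(S_t + P_t Z).
   As f' is 2/sigma^2-Lipschitz, expanding around S_{t-1} bounds
   G_t X_t + H(S_t, P_t) - H(S_{t-1}, P_{t-1}) by (G_t^2 - C_t) W_t plus the cubic
   error term, where W_t = - E_Z f'(S_{t-1} + P_t Z) is F_{t-1}-measurable and lies
   in [0, sqrt(2/pi)/sigma], h being convex.  Under the expectation, G_t^2 W_t
   becomes V_t W_t, and the differences of H telescope.  G_t^2 W_t need not be
   integrable a priori, but C_t W_t = H(S_{t-1}, P_{t-1}) - H(S_{t-1}, P_t) is
   bounded, so it can be moved across the inequality.

   The estimates on f' come from the normalised equation f' - x f = k - E k(Z) with
   k 1-Lipschitz: f' = x f + k - E k(Z), and x f is 1-Lipschitz.  The constant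
   sqrt(2/pi) is the inequality E(Z-x)^+ E(x-Z)^+ <= phi(0) phi(x). *)

Require Import Defs.
From HB Require Import structures.
From mathcomp Require Import all_boot all_order all_algebra.
From mathcomp Require Import all_classical all_reals all_analysis.
From mathcomp Require Import measurable_realfun.
From mathcomp Require Import ring lra.
Import Order.TTheory GRing.Theory Num.Theory.
Import numFieldNormedType.Exports.

Set Implicit Arguments.
Unset Strict Implicit.
Unset Printing Implicit Defensive.

Local Open Scope classical_set_scope.
Local Open Scope ring_scope.

(** No moment of the losses is assumed, so integrability has to come from the claim itself. If the
    error term is infinite there is nothing to prove; if it is finite, its cubic part controls
    |G_t|^3 because P_{t-1} <= P_0. Hence G_t is integrable, and so are the differences of H, which
    are bounded by |G_t| plus a constant.

    The solution of Stein's equation is specified as the unique bounded one, which says nothing of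
    its measurability in (S_{t-1}, P_{t-1}). It is therefore identified with an explicit quotient of
    a Gaussian integral by the density, and both the estimates and the measurability statements
    concern that quotient.

    A conditional expectation is known only through its integrals over the sets of F_{t-1};
    exchanging G_t^2 for V_t under the weight W_t rests on approximating W_t from below by simple
    functions. *)

Local Notation below x := (`]-oo, x]%classic : set (measurableTypeR _)).
Local Notation above x := (`]x, +oo[%classic : set (measurableTypeR _)).

(** * Derivatives and the normal density *)

Section derivatives.
Context {R : realType}.
Implicit Types f g df : R -> R.

(** The rules below produce a derivative in the shape dictated by the expression; this one replaces
    it by the wanted value, leaving an identity for [ring] or [field]. *)
Lemma derE f (x a b : R) : is_derive x 1 f a -> a = b -> is_derive x 1 f b.
Proof. by move=> fa <-. Qed.

Lemma derD f g (x a b : R) : is_derive x 1 f a -> is_derive x 1 g b ->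
  is_derive x 1 (fun t => f t + g t) (a + b).
Proof. by move=> fa gb; exact: is_deriveD. Qed.

Lemma derB f g (x a b : R) : is_derive x 1 f a -> is_derive x 1 g b ->
  is_derive x 1 (fun t => f t - g t) (a - b).
Proof. by move=> fa gb; exact: is_deriveB. Qed.

Lemma derN f (x a : R) : is_derive x 1 f a -> is_derive x 1 (fun t => - f t) (- a).
Proof. by move=> fa; exact: is_deriveN. Qed.

Lemma derM f g (x a b : R) : is_derive x 1 f a -> is_derive x 1 g b ->
  is_derive x 1 (fun t => f t * g t) (a * g x + f x * b).
Proof.
move=> fa gb; apply: (derE (is_deriveM fa gb)).
by rewrite /GRing.scale/= addrC; congr (_ + _); rewrite mulrC.
Qed.

Lemma derC (c x : R) : is_derive x 1 (fun _ => c) (0 : R).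
Proof. exact: is_derive_cst. Qed.

Lemma derid (x : R) : is_derive x 1 (fun t : R => t) (1 : R).
Proof. exact: is_derive_id. Qed.

Lemma derV f (x a : R) : is_derive x 1 f a -> f x != 0 ->
  is_derive x 1 (fun t => (f t)^-1) (- a / f x ^+ 2).
Proof.
move=> fa f0; apply: (derE (is_deriveV f0 fa)).
by rewrite /GRing.scale/= mulNr mulrC mulNr.
Qed.

Lemma dercomp f g (x a b : R) : is_derive x 1 g b -> is_derive (g x) 1 f a ->
  is_derive x 1 (fun t => f (g t)) (a * b).
Proof.
by move=> gb fa; exact: is_derive1_comp.
Qed.

Lemma der_continuous f (x a : R) : is_derive x 1 f a -> {for x, continuous f}.
Proof.
move=> fa; apply: differentiable_continuous; apply/derivable1_diffP.
exact: (@ex_derive _ _ _ _ _ _ _ fa).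
Qed.

Lemma der_continuousT f df : (forall x : R, is_derive x 1 f (df x)) -> continuous f.
Proof. by move=> fd x; exact: der_continuous (fd x). Qed.

Lemma mvt f df (a b : R) : a <= b -> (forall x : R, is_derive x 1 f (df x)) ->
  exists2 c, a <= c <= b & f b - f a = df c * (b - a).
Proof.
move=> ab fd.
have [] := @MVT_segment R f df a b ab (fun x _ => fd x).
  by apply: continuous_subspaceT; exact: der_continuousT fd.
by move=> c; rewrite in_itv/= => cab ?; exists c.
Qed.

Lemma nondecreasing_der f df (a b : R) : a <= b ->
  (forall x : R, is_derive x 1 f (df x)) ->
  (forall x, a <= x <= b -> 0 <= df x) -> f a <= f b.
Proof.
move=> ab fd df0; rewrite -subr_ge0; have [c cab ->] := mvt ab fd.
by rewrite mulr_ge0 ?subr_ge0// df0.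
Qed.

(** Differentiability is asked on the segment alone because the function [n] studied below has a
    pole at 0. *)
Lemma nonincreasing_der_on f df (a b : R) : a <= b ->
  (forall x : R, a <= x <= b -> is_derive x 1 f (df x)) ->
  (forall x, a <= x <= b -> df x <= 0) -> f b <= f a.
Proof.
move=> ab fd df0; rewrite -subr_le0.
have [||c] := @MVT_segment R f df a b ab.
- by move=> x xab; apply: fd; move: xab; rewrite in_itv/= => /andP[/ltW-> /ltW->].
- apply/continuous_in_subspaceT => x; rewrite inE/= in_itv/= => xab.
  exact: der_continuous (fd _ xab).
- rewrite in_itv/= => cab ->.
  by rewrite mulr_le0_ge0 ?subr_ge0// df0.
Qed.

Lemma lipschitz_der f df (L : R) : (forall x : R, is_derive x 1 f (df x)) ->
  (forall x, `|df x| <= L) -> forall x y, `|f x - f y| <= L * `|x - y|.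
Proof.
move=> fd dfL x y; wlog yx : x y / y <= x => [hw|].
  case: (leP y x) => [yx|/ltW xy]; first exact: hw.
  by rewrite distrC (distrC x); exact: hw.
by have [c _ ->] := mvt yx fd; rewrite normrM ler_wpM2r.
Qed.

End derivatives.

Section normal_density_calculus.
Context {R : realType}.

Definition phi : R -> R := normal_pdf 0 1.

Lemma phiE x : phi x = phi 0 * expR (- (x ^+ 2 / 2)).
Proof.
rewrite /phi normal_pdfE ?oner_eq0// /normal_fun !subr0 expr1n.
by rewrite expr0n/= oppr0 mul0r expR0 mulr1 mulNr.
Qed.

Lemma phi0E : phi 0 = (Num.sqrt (pi *+ 2))^-1.
Proof.
rewrite /phi normal_pdfE ?oner_eq0// /normal_fun subrr expr0n/= oppr0.
by rewrite mul0r expR0 mulr1 /normal_peak expr1n mul1r.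
Qed.

Lemma phi0_gt0 : 0 < phi 0.
Proof. by rewrite phi0E invr_gt0 sqrtr_gt0 pmulrn_lgt0// pi_gt0. Qed.

Lemma phi_gt0 x : 0 < phi x.
Proof. by rewrite phiE mulr_gt0 ?phi0_gt0// expR_gt0. Qed.

Lemma phi_ge0 x : 0 <= phi x. Proof. exact/ltW/phi_gt0. Qed.

Lemma phi_neq0 x : phi x != 0. Proof. exact/lt0r_neq0/phi_gt0. Qed.

Lemma phiN x : phi (- x) = phi x.
Proof. by rewrite phiE [RHS]phiE sqrrN. Qed.

Lemma two_phi0 : 2 * phi 0 = Num.sqrt (2 / pi).
Proof.
rewrite phi0E -[LHS]ger0_norm; last first.
  by rewrite mulr_ge0// invr_ge0 sqrtr_ge0.
rewrite -sqrtr_sqr; congr Num.sqrt.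
rewrite exprMn exprVn sqr_sqrtr; last by rewrite mulrn_wge0// pi_ge0.
have p0 := pi_gt0 R.
by move: (@pi R) p0 => p p0; field; rewrite gt_eqF.
Qed.

Lemma der_phi (x : R) : is_derive x 1 phi (- x * phi x).
Proof.
have E : (fun t => phi 0 * expR (- (t * t * 2^-1))) = phi.
  by apply/funext => t; rewrite [RHS]phiE expr2.
rewrite -[X in is_derive _ _ X]E; apply: derE.
by rewrite /GRing.scale/= [in RHS]phiE expr2; field.
Qed.

Lemma continuous_phi : continuous phi.
Proof. exact: der_continuousT der_phi. Qed.

Lemma measurable_phi : measurable_fun [set: R] phi.
Proof. exact: measurable_normal_pdf. Qed.

(* [e^(x^2/2) >= 1 + x^2/2 >= (1 + |x|)^2 / 4] *)
Lemma phi_decay x : (1 + `|x|) * phi x <= 4 * phi 0 / (1 + `|x|).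
Proof.
have x0 : 0 < 1 + `|x| by rewrite ltr_pwDl.
rewrite ler_pdivlMr// phiE expRN.
have := expR_ge1Dx (x ^+ 2 / 2).
have : 0 < expR (x ^+ 2 / 2) by rewrite expR_gt0.
set e := expR _ => e0 ex.
rewrite [leLHS](_ : _ = phi 0 * ((1 + `|x|) ^+ 2 / e)); last by ring.
rewrite [leRHS]mulrC ler_pM2l ?phi0_gt0// ler_pdivrMr//.
move: ex; have := sqr_ge0 (1 - `|x|); rewrite -[x ^+ 2]real_normK ?num_real//.
nra.
Qed.

End normal_density_calculus.

(** * Integration against weights *)

Section weighted_integrals.
Context {R : realType} d d' (T : measurableType d) (T' : measurableType d').
Variables (m n : {measure set T -> \bar R}) (pr : T -> T').
Hypothesis mpr : measurable_fun setT pr.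
Local Open Scope ereal_scope.

Import HBNNSimple.

Let integral_nnsfunM (nu : {measure set T -> \bar R}) (W : {nnsfun T' >-> R})
    (f : T -> \bar R) :
  (forall x, 0 <= f x) -> measurable_fun setT f ->
  \int[nu]_x ((W (pr x))%:E * f x) =
  \sum_(k \in range W)
    (k%:E * \int[nu]_(x in pr @^-1` (W @^-1` [set k])) f x).
Proof.
move=> f0 mf.
have mW k : measurable (pr @^-1` (W @^-1` [set k])).
  by rewrite -[X in measurable X]setTI; exact: mpr.
transitivity (\int[nu]_x \sum_(k \in range W)
    (k%:E * (f \_ (pr @^-1` (W @^-1` [set k]))) x)).
  apply: eq_integral => x _; rewrite fimfunE -fsumEFin//.
  rewrite ge0_mule_fsuml; last first.
    by move=> r; rewrite EFinM nnfun_muleindic_ge0.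
  apply: eq_fsbigr => k /= _; rewrite EFinM -muleA; congr (_ * _).
  rewrite patchE indicE.
  by have [xk|xk] := pselect (W (pr x) = k); [rewrite !mem_set// mul1e|
    rewrite !memNset// mul0e].
have Wk k : range W k -> (0 <= k)%R by move=> [x _ <-].
have mfk k : measurable_fun setT (f \_ (pr @^-1` (W @^-1` [set k]))).
  exact/(measurable_restrictT _ _).1/measurable_funTS.
have fk0 k x : 0 <= (f \_ (pr @^-1` (W @^-1` [set k]))) x.
  by rewrite patchE; case: ifP.
(* Exchanging sum and integral asks for nonnegative terms at every index [k], not only at the values
   of [W]; the maximum with 0 ensures this and changes nothing on the range. *)
transitivity (\int[nu]_x \sum_(k \in range W)
    (maxe k%:E 0 * (f \_ (pr @^-1` (W @^-1` [set k]))) x)).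
  apply: eq_integral => x _; apply: eq_fsbigr => k /set_mem kW.
  by congr (_ * _); rewrite max_l// lee_fin Wk.
rewrite ge0_integral_fsum//=.
- apply: eq_fsbigr => k /set_mem /Wk k0.
  rewrite max_l ?lee_fin// ge0_integralZl//.
  by rewrite -integral_mkcond.
- by move=> k; apply: emeasurable_funM => //; exact: measurable_cst.
- by move=> k x _; rewrite mule_ge0// le_max lexx orbT.
Qed.

(** The hypothesis is the case of an indicator [W]; linearity gives simple functions and monotone
    convergence the rest. The map [pr] allows [W] to be measurable for a coarser sigma-algebra, and
    the two measures allow a change of measure. *)
Lemma le_integral_weight (f g : T -> \bar R) (W : T' -> R) :
  (forall x, 0 <= f x) -> measurable_fun setT f ->
  (forall x, 0 <= g x) -> measurable_fun setT g ->
  (forall y, (0 <= W y)%R) -> measurable_fun setT W ->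
  (forall A, measurable A -> \int[m]_(x in pr @^-1` A) f x <=
                             \int[n]_(x in pr @^-1` A) g x) ->
  \int[m]_x ((W (pr x))%:E * f x) <= \int[n]_x ((W (pr x))%:E * g x).
Proof.
move=> f0 mf g0 mg W0 mW fg.
have mEW : measurable_fun setT (EFin \o W) by exact/measurable_EFinP.
pose a := nnsfun_approx measurableT mEW.
have lim (nu : {measure set T -> \bar R}) (h : T -> \bar R) :
    (forall x, 0 <= h x) -> measurable_fun setT h ->
    \int[nu]_x ((a k (pr x))%:E * h x) @[k --> \oo] -->
    \int[nu]_x ((W (pr x))%:E * h x).
  move=> h0 mh.
  rewrite (_ : (fun x => _) = fun x => limn (fun k => (a k (pr x))%:E * h x)).
    apply: cvg_monotone_convergence => //.
    - move=> k; apply: emeasurable_funM => //; apply/measurable_EFinP.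
      exact: measurableT_comp.
    - by move=> k x _; rewrite mule_ge0// lee_fin.
    - move=> x _ k l kl; rewrite lee_wpmul2r// lee_fin.
      exact/lefP/nd_nnsfun_approx.
  apply/funext => x; apply/esym/cvg_lim => //.
  have EW0 y : setT y -> 0 <= (EFin \o W) y by rewrite /= lee_fin.
  have aW : (a k (pr x))%:E @[k --> \oo] --> (W (pr x))%:E.
    exact: (cvg_nnsfun_approx measurableT mEW EW0).
  (* Where the weight vanishes, [h x] may be +oo and the product rule for limits does not apply; but
     there all approximants vanish as well. *)
  have [W0x|W0x] := eqVneq (W (pr x)) 0%R.
    under eq_fun => k.
      have -> : a k (pr x) = 0%R.
        apply/eqP; rewrite eq_le fun_ge0 andbT -lee_fin -W0x /a nnsfun_approxE.
        exact: (@le_approx _ _ _ _ _ k (pr x) EW0 Logic.I).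
      over.
    by rewrite W0x; under eq_fun do rewrite mul0e; rewrite mul0e; exact: cvg_cst.
  apply: cvgeM => //; last exact: cvg_cst.
  by rewrite /mule_def; case: (h x).
have al := lim m f f0 mf; have bl := lim n g g0 mg.
rewrite -(cvg_lim _ al)// -(cvg_lim _ bl)//; apply: lee_lim.
- by apply/cvg_ex; eexists; exact: al.
- by apply/cvg_ex; eexists; exact: bl.
apply: nearW => k; rewrite !integral_nnsfunM//.
apply: lee_fsum => // r [x _ <-]; apply: lee_wpmul2l.
  by rewrite lee_fin.
by apply: fg; exact: measurable_funPTI.
Qed.

End weighted_integrals.

(** * Gaussian integrals *)

Section gaussian_integrals.
Context {R : realType}.
Notation mu := (@lebesgue_measure R).
Implicit Types (g f : R -> R) (D : set (measurableTypeR R)).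

(** Integrating 1 against the normal law over [A] amounts to integrating [phi] over [A];
    [le_integral_weight], used in both directions, transfers this from sets to weights. *)
Let ge0_integral_normal (W : R -> R) : (forall x, 0 <= W x) ->
    measurable_fun setT W ->
  (\int[normal_prob (0 : R) 1]_x (W x)%:E = \int[mu]_x (W x * phi x)%:E)%E.
Proof.
move=> W0 mW.
have cst1 A : measurable A -> (\int[normal_prob (0 : R) 1]_(x in id @^-1` A) 1 =
    \int[mu]_(x in id @^-1` A) (phi x)%:E)%E.
  by move=> mA; rewrite integral_cst// mul1e.
have p0 x : (0 <= (@phi R x)%:E)%E by rewrite lee_fin phi_ge0.
have mp : measurable_fun setT (fun x => (@phi R x)%:E).
  by apply/measurable_EFinP; exact: measurable_phi.
transitivity (\int[normal_prob (0 : R) 1]_x ((W x)%:E * 1))%E.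
  by apply: eq_integral => x _; rewrite mule1.
transitivity (\int[mu]_x ((W x)%:E * (phi x)%:E))%E; last first.
  by apply: eq_integral => x _; rewrite EFinM.
by apply/eqP; rewrite eq_le; apply/andP; split;
  apply: (le_integral_weight (pr := id)) => // A mA; rewrite cst1.
Qed.

Lemma gaussian_expectationE g : measurable_fun setT g ->
  gaussian_expectation g = \int[mu]_t (g t * phi t).
Proof.
move=> mg; rewrite /gaussian_expectation /Rintegral; congr fine.
rewrite integralE [RHS]integralE; congr (_ - _)%E.
- transitivity (\int[normal_prob (0 : R) 1]_x (g^\+ x)%:E)%E.
    by apply: eq_integral => x _; rewrite funeposE /funrpos -EFin_max.
  rewrite ge0_integral_normal//; last exact: measurable_funrpos.
  apply: eq_integral => x _; rewrite funeposE /funrpos -EFin_max; congr EFin.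
  by rewrite maxr_pMl ?phi_ge0// mul0r.
- transitivity (\int[normal_prob (0 : R) 1]_x (g^\- x)%:E)%E.
    by apply: eq_integral => x _; rewrite funenegE /funrneg -EFinN -EFin_max.
  rewrite ge0_integral_normal//; last exact: measurable_funrneg.
  apply: eq_integral => x _; rewrite funenegE /funrneg -EFinN -EFin_max.
  by congr EFin; rewrite maxr_pMl ?phi_ge0// mul0r mulNr.
Qed.

(** A class of integrands closed under the operations used below; degree two is reached by the
    truncated second moments. *)
Definition quad_growth g := measurable_fun [set: R] g /\
  exists c, forall t, `|g t| <= c * (1 + t ^+ 2).

(** The majorant is a multiple of the density of variance 2: splitting e^(-t^2/2) into two factors
    e^(-t^2/4), one is that density up to its peak, and the other absorbs the growth since 1 + t^2
    <= 4 e^(t^2/4). *)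
Lemma quad_growth_integrable g : quad_growth g ->
  mu.-integrable setT (fun t => (g t * phi t)%:E).
Proof.
move=> [mg [c gc]].
have s2 : Num.sqrt 2 != 0 :> R by rewrite gt_eqF// sqrtr_gt0.
apply: (le_integrable measurableT _ _ (integrableZl measurableT
    (`|c| * 4 * phi 0 / normal_peak (Num.sqrt 2)) (integrable_normal_pdf 0 (Num.sqrt 2)))).
  apply/measurable_EFinP; apply: measurable_funM => //; exact: measurable_phi.
move=> t _ /=; rewrite lee_fin normrM (ger0_norm (phi_ge0 _)).
rewrite [leRHS]ger0_norm; last first.
  by rewrite mulr_ge0 ?normal_pdf_ge0// divr_ge0 ?normal_peak_ge0// !mulr_ge0// phi_ge0.
rewrite (normal_pdfE 0 s2)/= phiE /normal_fun subr0 sqr_sqrtr// [leRHS]mulrA divfK; last first.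
  by rewrite gt_eqF// normal_peak_gt0.
have -> : - (t ^+ 2 / 2) = - t ^+ 2 / (2 *+ 2) + - (t ^+ 2 / 4).
  by field.
rewrite expRD expRN [in leRHS]mulrC mulrA [leLHS]mulrA.
set e := expR (- t ^+ 2 / _).
have e0 : 0 < e by rewrite expR_gt0.
have := expR_ge1Dx (t ^+ 2 / 4).
have : 0 < expR (t ^+ 2 / 4) by rewrite expR_gt0.
set E := expR (t ^+ 2 / 4) => E0 Et.
rewrite [leRHS](_ : _ = (`|c| * (4 * E)) / E * phi 0 * e); last first.
  by field; rewrite gt_eqF.
rewrite [leLHS](_ : _ = `|g t| / E * phi 0 * e); last by ring.
rewrite !ler_pM2r ?phi0_gt0 ?invr_gt0//.
apply: (le_trans (gc t)); rewrite (@le_trans _ _ (`|c| * (1 + t ^+ 2)))//.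
  by rewrite ler_wpM2r ?ler_norm// addr_ge0 ?sqr_ge0.
by rewrite ler_wpM2l//; have := sqr_ge0 t; lra.
Qed.

Lemma quad_growth_cst (c : R) : quad_growth (fun=> c).
Proof.
split => //; exists `|c| => t.
by rewrite ler_peMr// lerDl sqr_ge0.
Qed.

Lemma quad_growth_id : quad_growth (fun t : R => t).
Proof.
split => //; exists 1 => t; rewrite mul1r.
have := sqr_ge0 (`|t| - 1); rewrite -[t ^+ 2]real_normK ?num_real//.
by have := normr_ge0 t; nra.
Qed.

Lemma quad_growth_sqr : quad_growth (fun t : R => t ^+ 2).
Proof.
split; first exact: exprn_measurable.
by exists 1 => t; rewrite mul1r ger0_norm ?sqr_ge0// lerDr.
Qed.

Lemma quad_growthD f g : quad_growth f -> quad_growth g ->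
  quad_growth (fun t => f t + g t).
Proof.
move=> [mf [c fc]] [mg [c' gc']]; split; first exact: measurable_funD.
by exists (c + c') => t; rewrite mulrDl (le_trans (ler_normD _ _))// lerD.
Qed.

Lemma quad_growthZ (k : R) g : quad_growth g -> quad_growth (fun t => k * g t).
Proof.
move=> [mg [c gc]]; split; first exact: measurable_funM.
by exists (`|k| * c) => t; rewrite normrM -mulrA ler_wpM2l.
Qed.

Lemma quad_growthB f g : quad_growth f -> quad_growth g ->
  quad_growth (fun t => f t - g t).
Proof.
move=> qf qg.
have -> : (fun t => f t - g t) = (fun t => f t + -1 * g t).
  by apply/funext => t; rewrite mulN1r.
by apply: quad_growthD => //; exact: quad_growthZ.
Qed.

Lemma quad_growth_bounded f (c : R) : measurable_fun setT f ->
  (forall t, `|f t| <= c) -> quad_growth f.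
Proof.
move=> mf fc; split => //; exists c => t; rewrite (le_trans (fc t))// ler_peMr//.
  exact: le_trans (fc t).
by rewrite lerDl sqr_ge0.
Qed.

Lemma quad_growth_idM f (c : R) : measurable_fun setT f ->
  (forall t, `|f t| <= c) -> quad_growth (fun t => t * f t).
Proof.
move=> mf fc; split; first exact: measurable_funM.
have [_ [c' h]] := quad_growth_id.
exists (c' * c) => t; rewrite normrM mulrAC; apply: ler_pM => //.
Qed.

(** Written with the Lebesgue measure and an explicit density, so that the fundamental theorem of
    calculus applies to a moving endpoint of [D]. *)
Definition gint D g := \int[mu]_(t in D) (g t * phi t).

Lemma gintT g : quad_growth g -> gint setT g = gaussian_expectation g.
Proof. by move=> [mg _]; rewrite gaussian_expectationE. Qed.

Let int D g : measurable D -> quad_growth g ->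
  mu.-integrable D (EFin \o (fun t => g t * phi t)).
Proof.
by move=> mD /quad_growth_integrable; apply: integrableS.
Qed.

Lemma gintD D f g : measurable D -> quad_growth f -> quad_growth g ->
  gint D (fun t => f t + g t) = gint D f + gint D g.
Proof.
move=> mD qf qg; rewrite /gint -RintegralD//; try exact: int.
by apply: eq_Rintegral => t _; rewrite mulrDl.
Qed.

Lemma gintZ D (k : R) g : measurable D -> quad_growth g ->
  gint D (fun t => k * g t) = k * gint D g.
Proof.
move=> mD qg; rewrite /gint -RintegralZl//; try exact: int.
by apply: eq_Rintegral => t _; rewrite mulrA.
Qed.

Lemma gintB D f g : measurable D -> quad_growth f -> quad_growth g ->
  gint D (fun t => f t - g t) = gint D f - gint D g.
Proof.
move=> mD qf qg; rewrite /gint -RintegralB//; try exact: int.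
by apply: eq_Rintegral => t _; rewrite mulrBl.
Qed.

Lemma le_gint D f g : measurable D -> quad_growth f -> quad_growth g ->
  (forall t, D t -> f t <= g t) -> gint D f <= gint D g.
Proof.
move=> mD qf qg fg; apply: le_Rintegral => //; try exact: int.
by move=> t Dt; rewrite ler_wpM2r ?phi_ge0// fg.
Qed.

Lemma gint_ge0 D f : (forall t, D t -> 0 <= f t) -> 0 <= gint D f.
Proof.
by move=> f0; apply: Rintegral_ge0 => t Dt; rewrite mulr_ge0 ?phi_ge0// f0.
Qed.

Lemma le_norm_gint D f g : measurable D -> quad_growth f -> quad_growth g ->
  (forall t, D t -> `|f t| <= g t) -> `|gint D f| <= gint D g.
Proof.
move=> mD qf qg fg; rewrite ler_norml -mulN1r -gintZ// !le_gint//.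
- by move=> t /fg /ler_normlP[].
- exact: quad_growthZ.
- by move=> t /fg /ler_normlP[? _]; rewrite mulN1r lerNl.
Qed.


Lemma gint_split x g : quad_growth g ->
  gint (below x) g + gint (above x) g = gint setT g.
Proof.
move=> qg; rewrite /gint -Rintegral_setU//.
- congr (\int[mu]_(t in _) _); apply/seteqP; split => // t _ /=.
  by rewrite !in_itv/= andbT; case: (leP t x); [left|right].
- by apply: int => //; exact: measurableU.
- rewrite disj_set2E; apply/eqP/seteqP; split => // t []/=.
  by rewrite !in_itv/= andbT => ?; rewrite ltNge => /negP.
Qed.

Lemma der_gint_below g (x : R) : quad_growth g -> continuous g ->
  is_derive x 1 (fun y => gint (below y) g) (g x * phi x).
Proof.
move=> qg cg.
have xx1 : x < x + 1 by rewrite ltrDl.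
have ix : mu.-integrable [set` Interval -oo%O (BRight (x + 1))]
    (EFin \o (fun t => g t * phi t)) by exact: int.
have [] := continuous_FTC1 xx1 ix.
- by rewrite ltNyr.
- by apply: continuousM; [exact: cg|exact: continuous_phi].
move=> dF F'; apply: DeriveDef => //.
by rewrite -derive1E F'.
Qed.

(** Dominated convergence with majorant |g phi|. In both uses the limit [b] of the indicators is
    constant, 0 or 1. *)
Lemma cvg_gint (D : nat -> set (measurableTypeR R)) (b : R -> R) g :
  quad_growth g -> (forall n, measurable (D n)) -> measurable_fun setT b ->
  (forall t, (\1_(D n) t : R) @[n --> \oo] --> b t) ->
  gint (D n) g @[n --> \oo] --> gint setT (fun t => b t * g t).
Proof.
move=> qg mD mb Db; have ig := quad_growth_integrable qg.
have mgp : measurable_fun setT (fun t => g t * phi t).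
  by apply/measurable_EFinP; exact: measurable_int ig.
pose f_ n (t : R) := (\1_(D n) t * (g t * phi t))%:E.
have [|||||if_ _ lim] := @dominated_convergence _ _ _ mu setT measurableT f_
  (fun t => (b t * (g t * phi t))%:E) (fun t => `|(g t * phi t)%:E|%E).
- by move=> n; apply/measurable_EFinP; apply: measurable_funM.
- by apply/measurable_EFinP; apply: measurable_funM.
- apply: aeW => t _; apply: cvg_EFin; first exact: nearW.
  by apply: cvgM; [exact: Db|exact: cvg_cst].
- exact: integrable_abse.
- apply: aeW => t n _; rewrite /f_ /= lee_fin normrM ler_piMl//.
  by rewrite indicE; case: (_ \in _); rewrite ?normr1 ?normr0.
have -> : gint setT (fun t => b t * g t) =
    fine (\int[mu]_t (b t * (g t * phi t))%:E)%E.
  by congr fine; apply: eq_integral => t _; rewrite mulrA.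
rewrite (_ : (fun n => _) = fun n => fine (\int[mu]_t f_ n t)%E).
  apply: fine_cvg; rewrite fineK//; exact: integrable_fin_num.
apply/funext => n; rewrite /gint Rintegral_mkcond; congr fine.
apply: eq_integral => t _; rewrite patchE /f_ indicE.
by case: (_ \in _); rewrite ?mul1r ?mul0r.
Qed.

Let cvg_harmonic_bound (c : R) : c / (1 + n%:R) @[n --> \oo] --> (0 : R).
Proof.
rewrite -[X in _ --> X](mulr0 c); apply: cvgM; first exact: cvg_cst.
under eq_fun do rewrite addrC natr1.
exact: cvg_harmonic.
Qed.

Lemma cvg_gint_belowN g : quad_growth g ->
  gint (below (- n%:R)) g @[n --> \oo] --> (0 : R).
Proof.
move=> qg; have -> : 0 = gint setT (fun t => 0 * g t).
  by rewrite gintZ// mul0r.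
apply: cvg_gint => // t.
apply: cvg_near_cst; near=> n; rewrite indicE memNset//= in_itv/=.
apply/negP; rewrite -ltNge ltrNl.
near: n; exact: nbhs_infty_gtr.
Unshelve. all: by end_near. Qed.

Lemma cvg_gint_belowy g : quad_growth g ->
  gint (below n%:R) g @[n --> \oo] --> gint setT g.
Proof.
move=> qg; have -> : gint setT g = gint setT (fun t => 1 * g t).
  by rewrite gintZ// mul1r.
apply: cvg_gint => // t.
apply: cvg_near_cst; near=> n; rewrite indicE mem_set//= in_itv/=.
near: n; exact: nbhs_infty_ger.
Unshelve. all: by end_near. Qed.

(* The bound on [F] makes it vanish at both infinities. *)
Lemma gint_below_der (F g : R -> R) (K : R) : quad_growth g -> continuous g ->
  (forall x : R, is_derive x 1 F (g x * phi x)) ->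
  (forall x, `|F x| <= K * ((1 + `|x|) * phi x)) ->
  (forall x, gint (below x) g = F x) /\ gint setT g = 0.
Proof.
move=> qg cg dF FK.
have F0 (a : nat -> R) : (forall n, `|a n| = n%:R) ->
    F (a n) @[n --> \oo] --> (0 : R).
  move=> an; apply/norm_cvg0P.
  apply: (@squeeze_cvgr _ _ _ _ (fun=> 0) (fun n => `|K| * (4 * phi 0) / (1 + n%:R))).
  - near=> n; rewrite normr_ge0/= (le_trans (FK _))//.
    rewrite (@le_trans _ _ (`|K| * ((1 + `|a n|) * phi (a n))))//.
      by rewrite ler_wpM2r ?ler_norm// mulr_ge0 ?phi_ge0// addr_ge0.
    by rewrite -[leRHS]mulrA ler_wpM2l// -(an n) phi_decay.
  - exact: cvg_cst.
  - exact: cvg_harmonic_bound.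
(* Both terms are antiderivatives of g phi, so their difference is constant; its value is read off
   along the points -n. *)
have cst x y : gint (below x) g - F x = gint (below y) g - F y.
  apply: (@is_derive_0_is_cst _ (fun x => gint (below x) g - F x)) => z.
  by apply: (derE (derB (der_gint_below z qg cg) (dF z))); rewrite subrr.
have eqF x : gint (below x) g = F x.
  apply/eqP; rewrite -subr_eq0; apply/eqP.
  have : gint (below (- n%:R)) g - F (- n%:R) @[n --> \oo] --> (0 : R) - 0.
    apply: cvgB; first exact: cvg_gint_belowN.
    by apply: F0 => n; rewrite normrN ger0_norm.
  rewrite subr0 (_ : (fun n => _) = fun=> gint (below x) g - F x).
    by move/cvg_lim => <-//; rewrite lim_cst.
  by apply/funext => n; exact: cst.
split=> //.
have := cvg_gint_belowy qg; under eq_fun do rewrite eqF.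
move/cvg_lim => <-//; apply/cvg_lim => //; apply: F0 => n.
by rewrite ger0_norm.
Unshelve. all: by end_near. Qed.

End gaussian_integrals.

(** * Truncated moments of the standard normal law *)

Section gaussian_tails.
Context {R : realType}.
Notation phi := (@phi R).
Implicit Type x : R.

Definition Phi x : R := gint (below x) (fun=> 1).

Lemma gint_setT1 : gint setT (fun=> 1) = 1 :> R.
Proof.
rewrite gintT; last exact: quad_growth_cst.
by rewrite /gaussian_expectation Rintegral_cst// mul1r [X in fine X]integral_normal_pdf.
Qed.

Lemma gint_above1 x : gint (above x) (fun=> 1) = 1 - Phi x.
Proof.
by have := gint_split x (quad_growth_cst 1); rewrite gint_setT1 -/(Phi x); lra.
Qed.

Let ftc_id : (forall x, gint (below x) (fun t => - t) = phi x) /\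
  gint setT (fun t : R => - t) = 0.
Proof.
have q : quad_growth (fun t : R => - t).
  by under eq_fun do rewrite -mulN1r; exact/quad_growthZ/quad_growth_id.
apply: (gint_below_der (K := 1) q).
- by move=> x; apply: der_continuous.
- exact: der_phi.
- move=> x; rewrite mul1r ger0_norm ?phi_ge0// ler_peMl ?phi_ge0//.
  by rewrite lerDl.
Qed.

Let gintN (D : set (measurableTypeR R)) : measurable D ->
  gint D (fun t : R => - t) = - gint D (fun t => t).
Proof.
move=> mD; under [X in gint D X]eq_fun do rewrite -mulN1r.
by rewrite gintZ ?mulN1r//; exact: quad_growth_id.
Qed.

Lemma gint_below_id x : gint (below x) (fun t => t) = - phi x.
Proof. by rewrite -ftc_id.1 gintN// opprK. Qed.

Lemma gint_setT_id : gint setT (fun t : R => t) = 0.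
Proof. by apply/eqP; rewrite -oppr_eq0 -gintN// ftc_id.2. Qed.

Lemma gint_above_id x : gint (above x) (fun t => t) = phi x.
Proof.
have := gint_split x quad_growth_id.
by rewrite gint_below_id gint_setT_id addrC => /eqP; rewrite subr_eq0 => /eqP.
Qed.

Let ftc_sqr : (forall x, gint (below x) (fun t => 1 - t ^+ 2) = x * phi x) /\
  gint setT (fun t : R => 1 - t ^+ 2) = 0.
Proof.
have q : quad_growth (fun t : R => 1 - t ^+ 2).
  by apply: quad_growthB; [exact: quad_growth_cst|exact: quad_growth_sqr].
apply: (gint_below_der (K := 1) q).
- by move=> x; apply: der_continuous.
- move=> x; apply: (derE (derM (derid x) (der_phi x))); ring.
- move=> x; rewrite mul1r normrM (ger0_norm (phi_ge0 _)) ler_wpM2r ?phi_ge0//.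
  by rewrite lerDr.
Qed.

Let sqrE D : measurable D -> gint D (fun t : R => t ^+ 2) =
  gint D (fun=> 1) - gint D (fun t : R => 1 - t ^+ 2).
Proof.
move=> mD; rewrite -gintB//; [|exact: quad_growth_cst|].
  by congr gint; apply/funext => t; rewrite opprB addrC subrK.
by apply: quad_growthB; [exact: quad_growth_cst|exact: quad_growth_sqr].
Qed.

Lemma gint_below_sqr x : gint (below x) (fun t => t ^+ 2) = Phi x - x * phi x.
Proof. by rewrite sqrE// ftc_sqr.1. Qed.

Lemma gint_above_sqr x :
  gint (above x) (fun t => t ^+ 2) = 1 - Phi x + x * phi x.
Proof.
have := gint_split x quad_growth_sqr.
rewrite gint_below_sqr (sqrE measurableT) ftc_sqr.2 subr0 gint_setT1.
by lra.
Qed.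

Lemma der_Phi x : is_derive x 1 Phi (phi x).
Proof.
apply: (derE (der_gint_below x (quad_growth_cst 1) _)); last by rewrite mul1r.
exact: cst_continuous.
Qed.

Lemma Phi_ge0 x : 0 <= Phi x. Proof. exact: gint_ge0. Qed.

Lemma Phi_le1 x : Phi x <= 1.
Proof. by rewrite -subr_ge0 -gint_above1; exact: gint_ge0. Qed.

Lemma cvg_phi : phi n%:R @[n --> \oo] --> (0 : R).
Proof.
apply: (@squeeze_cvgr _ _ _ _ (fun=> 0) (fun n => (4 * phi 0) / (1 + n%:R))).
- apply: nearW => n; rewrite phi_ge0/=; have := phi_decay (n%:R : R).
  rewrite ger0_norm//; apply: le_trans.
  by rewrite ler_peMl ?phi_ge0// lerDl.
- exact: cvg_cst.
- rewrite -[X in _ --> X](mulr0 (4 * phi 0)); apply: cvgM; first exact: cvg_cst.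
  under eq_fun do rewrite addrC natr1.
  exact: cvg_harmonic.
Qed.

(** The sum Phi x + Phi (- x) has zero derivative because [phi] is even, and it tends to 1 at
    infinity. *)
Lemma PhiN x : Phi (- x) = 1 - Phi x.
Proof.
have cst y z : Phi y + Phi (- y) = Phi z + Phi (- z).
  apply: (@is_derive_0_is_cst _ (fun y => Phi y + Phi (- y))) => t.
  apply: (derE (derD (der_Phi t) (dercomp (derN (derid t)) (der_Phi (- t))))).
  by rewrite phiN mulrN1 subrr.
suff : Phi x + Phi (- x) = 1 by lra.
have : Phi n%:R + Phi (- n%:R) @[n --> \oo] --> (1 : R) + 0.
  apply: cvgD; last exact: (cvg_gint_belowN (quad_growth_cst 1)).
  by rewrite -[X in _ --> X]gint_setT1; exact: (cvg_gint_belowy (quad_growth_cst 1)).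
rewrite addr0 (_ : (fun n => _) = fun=> Phi x + Phi (- x)).
  by move/cvg_lim => <-//; rewrite lim_cst.
by apply/funext => n; exact: cst.
Qed.

Lemma Phi0 : Phi 0 = 1 / 2.
Proof. by have := PhiN 0; rewrite oppr0; lra. Qed.

Let nneg_gint (D : set (measurableTypeR R)) (a b c : R) : measurable D ->
  (forall t, D t -> 0 <= a * t ^+ 2 + (b * t + c * 1)) ->
  0 <= a * gint D (fun t => t ^+ 2) + (b * gint D (fun t => t) +
       c * gint D (fun=> 1)).
Proof.
move=> mD abc.
have q2 := quad_growthZ a quad_growth_sqr.
have q1 := quad_growthZ b quad_growth_id.
have q0 : quad_growth (fun t : R => c * (fun=> 1) t).
  exact/quad_growthZ/quad_growth_cst.
rewrite -!gintZ//; try exact: quad_growth_sqr; try exact: quad_growth_id;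
  try exact: quad_growth_cst.
rewrite -!gintD//; first exact: gint_ge0.
exact: quad_growthD.
Qed.

(* These are [E (Z - x)^+] and [E (x - Z)^+]. *)
Definition psip x : R := phi x - x * (1 - Phi x).
Definition psim x : R := phi x + x * Phi x.

Lemma gint_above_psip x : gint (above x) (fun t => t - x) = psip x.
Proof.
rewrite gintB//; [|exact: quad_growth_id|exact: quad_growth_cst].
rewrite gint_above_id /psip -gint_above1 -gintZ//; last exact: quad_growth_cst.
by congr (_ - gint _ _); apply/funext => t; rewrite mulr1.
Qed.

Lemma gint_below_psim x : gint (below x) (fun t => x - t) = psim x.
Proof.
rewrite gintB//; [|exact: quad_growth_cst|exact: quad_growth_id].
rewrite gint_below_id opprK addrC /psim /Phi -gintZ//; last exact: quad_growth_cst.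
by congr (_ + gint _ _); apply/funext => t; rewrite mulr1.
Qed.

Lemma psip_ge0 x : 0 <= psip x.
Proof.
rewrite -gint_above_psip; apply: gint_ge0 => t/=.
by rewrite in_itv/= andbT subr_ge0 => /ltW.
Qed.

Lemma psim_ge0 x : 0 <= psim x.
Proof.
by rewrite -gint_below_psim; apply: gint_ge0 => t/=; rewrite in_itv/= subr_ge0.
Qed.

(** The right-hand side is the expectation of the square of (Z - x)^+. It is the coefficient of the
    lower integral of [k] in f + x f'; the mirror statement that follows gives the other
    coefficient. *)
Lemma second_moment_above_ge0 x : 0 <= (1 + x ^+ 2) * (1 - Phi x) - x * phi x.
Proof.
have := @nneg_gint (above x) 1 (- 2 * x) (x ^+ 2).
rewrite gint_above_sqr gint_above_id gint_above1 => H.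
rewrite [leRHS](_ : _ = 1 * (1 - Phi x + x * phi x) +
    (-2 * x * phi x + x ^+ 2 * (1 - Phi x))); last by ring.
apply: H => // t _; have := sqr_ge0 (t - x); lra.
Qed.

Lemma second_moment_below_ge0 x : 0 <= (1 + x ^+ 2) * Phi x + x * phi x.
Proof.
have := second_moment_above_ge0 (- x).
by rewrite PhiN phiN sqrrN; lra.
Qed.

End gaussian_tails.

(** * The product of the two one-sided means of a normal variable *)

Section mills_product.
Context {R : realType}.
Notation phi := (@phi R).
Implicit Type x : R.

(** For x >= 0 this is the probability of |Z| <= x. It symmetrises the tails: Phi (1 - Phi) = (1 -
    e^2) / 4. *)
Let e x := 2 * Phi x - 1.

Let der_e x : is_derive x 1 e (2 * phi x).
Proof.
apply: (derE (derB (derM (derC 2 x) (der_Phi x)) (derC 1 x))).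
by rewrite mul0r add0r subr0.
Qed.

Let e0 : e 0 = 0. Proof. by rewrite /e Phi0; lra. Qed.

Let le_e x : 0 <= x -> 0 <= e x - x * phi x.
Proof.
move=> x0; have := @nondecreasing_der _ (fun t => e t - t * phi t) _ 0 x x0
  (fun t => derB (der_e t) (derM (derid t) (der_phi t))).
rewrite e0 mul0r subrr; apply => t /andP[t0 _].
rewrite [leRHS](_ : _ = (1 + t ^+ 2) * phi t); last by ring.
by rewrite mulr_ge0 ?phi_ge0// addr_ge0 ?sqr_ge0.
Qed.

(** The difference of the two sides vanishes at 0 and has derivative 2 t (e t - t phi t),
    nonnegative by [le_e]. The inequality gives the sign of the derivative of [n] below. *)
Let ge_e x : 0 <= x -> e x * (2 - x ^+ 2) <= 4 * x * phi x.
Proof.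
move=> x0; rewrite -subr_ge0.
pose f t := 4 * t * phi t - e t * (2 - t * t).
have df (t : R) : is_derive t 1 f (2 * t * (e t - t * phi t)).
  apply: (derE (derB (derM (derM (derC 4 t) (derid t)) (der_phi t))
    (derM (der_e t) (derB (derC 2 t) (derM (derid t) (derid t)))))).
  by ring.
have := nondecreasing_der x0 df; rewrite /f e0 !mulr0 !mul0r subrr expr2; apply.
by move=> t /andP[t0 _]; rewrite !mulr_ge0// le_e.
Qed.

(* The derivative of [phi 0 - psip psim / phi] is [N / phi], see [psip_psim_ge0],
   and [n = N / (x (2 + x^2))] is nonincreasing on the positive axis with limit 0. *)
Let n x := (1 - e x * e x) / 4
  - ((1 + x * x) / (x * (2 + x * x)) * (phi x * e x) + phi x * phi x / (2 + x * x)).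

Let der_n x : 0 < x -> is_derive x 1 n
  (phi x / (x ^+ 2 * (x ^+ 2 + 2) ^+ 2) * (e x * (2 - x ^+ 2) - 4 * x * phi x)).
Proof.
move=> x0; have xx : is_derive x 1 (fun t : R => t * t) (x + x).
  by apply: (derE (derM (derid x) (derid x))); rewrite mul1r mulr1.
have x2 : 0 < 2 + x * x by rewrite ltr_pwDl// -expr2 sqr_ge0.
have nz1 : x * (2 + x * x) != 0 by rewrite mulf_neq0 ?gt_eqF.
have nz2 : 2 + x * x != 0 by rewrite gt_eqF.
have d2 := derD (derC 2 x) xx.
apply: (derE (derB
  (derM (derB (derC 1 x) (derM (der_e x) (der_e x))) (derC 4^-1 x))
  (derD
    (derM (derM (derD (derC 1 x) xx) (derV (derM (derid x) d2) nz1))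
          (derM (der_phi x) (der_e x)))
    (derM (derM (der_phi x) (der_phi x)) (derV d2 nz2))))).
have x2' : x ^+ 2 + 2 != 0 by rewrite addrC expr2.
by field; rewrite x2' gt_eqF.
Qed.

Let n_ge0 x : 0 < x -> 0 <= n x.
Proof.
move=> x0.
(* From 1 on, the coefficient (1 + y^2) / (y (2 + y^2)) is at most 1, and e <= 1; so [n y] is at
   least - (phi y + phi y ^ 2), a bound that vanishes at infinity. *)
have nxy y : x <= y -> 1 <= y -> - (phi y + phi y * phi y) <= n x.
  move=> xy y1; apply: (@le_trans _ _ (n y)); last first.
    apply: (nonincreasing_der_on xy) => t /andP[xt _].
      by apply: der_n; exact: lt_le_trans xt.
    have t0 := lt_le_trans x0 xt.
    apply: mulr_ge0_le0; first by rewrite divr_ge0 ?phi_ge0// mulr_ge0 ?sqr_ge0.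
    by rewrite subr_le0; apply: ge_e; exact: ltW.
  have y0 : 0 < y by exact: lt_le_trans y1.
  have ey0 : 0 <= e y.
    by have := le_e (ltW y0); rewrite subr_ge0; apply: le_trans; rewrite mulr_ge0 ?phi_ge0// ltW.
  have ey1 : e y <= 1 by have := Phi_le1 y; rewrite /e; lra.
  rewrite /n; set a := _ / (y * _); set b := (2 + y * y).
  have b1 : 1 <= b by rewrite /b; nra.
  have a1 : a <= 1.
    by rewrite /a ler_pdivrMr ?mul1r; [nra|rewrite mulr_gt0// (lt_le_trans _ b1)].
  have a0 : 0 <= a.
    by rewrite /a divr_ge0 ?mulr_ge0 ?addr_ge0 ?mulr_ge0// ltW.
  have h1 : a * (phi y * e y) <= phi y.
    rewrite -[leRHS]mul1r ler_pM// ?mulr_ge0 ?phi_ge0//.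
    by rewrite ler_piMr ?phi_ge0.
  have h2 : phi y * phi y / b <= phi y * phi y.
    by rewrite ler_piMr ?mulr_ge0 ?phi_ge0// invf_le1// (lt_le_trans _ b1).
  have h3 : 0 <= (1 - e y * e y) / 4 by nra.
  lra.
have : - (phi k%:R + phi k%:R * phi k%:R) @[k --> \oo] --> - (0 + 0 * 0 : R).
  by apply: cvgN; apply: cvgD; [|apply: cvgM]; exact: cvg_phi.
rewrite mul0r addr0 oppr0 => lim.
rewrite -[leLHS](cvg_lim _ lim)//; apply: limr_le.
- by apply/cvg_ex; exists 0.
- near=> k; apply: nxy; near: k; exact: nbhs_infty_ger.
Unshelve. all: by end_near. Qed.

Let psip_psim_ge0 x : 0 <= x -> psip x * psim x <= phi 0 * phi x.
Proof.
move=> x0; rewrite -ler_pdivrMr ?phi_gt0// -subr_ge0.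
pose K t := phi 0 - psip t * psim t / phi t.
pose N t := t * (Phi t * (1 - Phi t)) * (2 + t ^+ 2) -
            ((1 + t ^+ 2) * (phi t * e t) + t * phi t ^+ 2).
have dp (t : R) : is_derive t 1 psip (- (1 - Phi t)).
  apply: (derE (derB (der_phi t) (derM (derid t) (derB (derC 1 t) (der_Phi t))))).
  by ring.
have dm (t : R) : is_derive t 1 psim (Phi t).
  apply: (derE (derD (der_phi t) (derM (derid t) (der_Phi t)))).
  by ring.
have dK (t : R) : is_derive t 1 K (N t / phi t).
  apply: (derE (derB (derC (phi 0) t) (derM (derM (dp t) (dm t))
    (derV (der_phi t) (phi_neq0 t))))).
  by rewrite /N /e /psip /psim; field; exact: phi_neq0.
have := nondecreasing_der x0 dK.
rewrite {1}/K {1}/psip {1}/psim mul0r subr0 mul0r addr0.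
rewrite mulfK ?phi_neq0// subrr; apply => t /andP[t0 _].
rewrite divr_ge0 ?phi_ge0//.
(* The factorisation of [N] through [n] divides by [t], so the origin is treated apart. *)
have [->|tn0] := eqVneq t 0; first by rewrite /N e0 !(mul0r, mulr0) addr0 subrr.
have tp : 0 < t by rewrite lt_neqAle eq_sym tn0.
have := n_ge0 tp.
have t2 : 0 < 2 + t * t by rewrite ltr_pwDl// -expr2 sqr_ge0.
rewrite (_ : N t = t * (2 + t * t) * n t).
  by move=> ?; rewrite !mulr_ge0// ltW.
rewrite /N /n /e; field; rewrite tn0 gt_eqF//.
Qed.

(** Reflection exchanges [psip] and [psim] and leaves [phi] unchanged, which reduces negative [x] to
    positive ones. *)
Lemma psip_psim_le x : psip x * psim x <= phi 0 * phi x.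
Proof.
have [x0|x0] := leP 0 x; first exact: psip_psim_ge0.
have psN (t : R) : psip (- t) = psim t by rewrite /psip /psim phiN PhiN; ring.
have psN' (t : R) : psim (- t) = psip t by rewrite -psN opprK.
rewrite -(phiN x) mulrC -(psN x) -(psN' x); apply: psip_psim_ge0.
by rewrite oppr_ge0 ltW.
Qed.

End mills_product.

(** * Stein's equation *)

Section standard_stein_equation.
Context {R : realType}.
Notation phi := (@phi R).
Implicit Type x : R.

(** The density is an integrating factor: (f phi)' = (f' - x f) phi, so f phi is the integral of (k
    - E k(Z)) phi from minus infinity. The derivative [dstein1] is then read off the equation
    itself. *)
Definition stein1 (k : R -> R) x : R :=
  gint (below x) (fun t => k t - gaussian_expectation k) / phi x.

Definition dstein1 (k : R -> R) x : R :=
  x * stein1 k x + (k x - gaussian_expectation k).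

Lemma lipschitz1_continuous (k : R -> R) :
  (forall x y, `|k x - k y| <= `|x - y|) -> continuous k.
Proof.
move=> kL x; apply/cvgrPdist_le => /= eps eps0; near=> t.
apply: (le_trans (kL _ _)); near: t.
by apply: cvgr_dist_le => //; exact: cvg_id.
Unshelve. all: by end_near. Qed.

Lemma lipschitz1_quad_growth (k : R -> R) :
  (forall x y, `|k x - k y| <= `|x - y|) -> quad_growth k.
Proof.
move=> kL; split.
  by apply: continuous_measurable_fun; exact: lipschitz1_continuous.
have [_ [c ct]] := @quad_growth_id R.
exists (`|k 0| + c) => t.
have := kL t 0; rewrite subr0 => kt.
rewrite mulrDl -[k t](subrK (k 0)) addrC (le_trans (ler_normD _ _))// lerD//.
  by rewrite ler_peMr// lerDl sqr_ge0.
exact: (le_trans kt).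
Qed.

Variable k : R -> R.
Hypothesis kL : forall x y, `|k x - k y| <= `|x - y|.
Hypothesis ksub : forall x, exists l, forall y, k x + l * (y - x) <= k y.

Notation m := (gaussian_expectation k).
Notation f := (stein1 k).
Notation f' := (dstein1 k).

Let qk : quad_growth k. Proof. exact: lipschitz1_quad_growth. Qed.
Let qc c : quad_growth (fun=> c : R). Proof. exact: quad_growth_cst. Qed.

Lemma der_stein1 (x : R) : is_derive x 1 f (f' x).
Proof.
have ck : continuous (fun t => k t - m).
  by move=> t; apply: cvgB; [exact: lipschitz1_continuous|exact: cvg_cst].
have qkm : quad_growth (fun t => k t - m) by exact: quad_growthB.
apply: (derE (derM (der_gint_below x qkm ck) (derV (der_phi x) (phi_neq0 x)))).
by rewrite /dstein1 /stein1; field; exact: phi_neq0.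
Qed.

(* Up to the factor [phi], the functions [f], [f'] and [f + x f'] are linear
   combinations of [A] and [B] whose coefficients do not depend on [k] and have
   constant signs; their extreme values are attained at [k t = t] and [k t = |t - x|]. *)
Let A x := gint (above x) (fun t => k t - k x).
Let B x := gint (below x) (fun t => k t - k x).

Let gintc (D : set (measurableTypeR R)) c : measurable D ->
  gint D (fun=> c) = c * gint D (fun=> 1).
Proof.
move=> mD; rewrite -gintZ//.
by congr gint; apply/funext => t; rewrite mulr1.
Qed.

Let ABE x : A x + B x = m - k x.
Proof.
rewrite addrC gint_split; last exact: quad_growthB.
rewrite gintB//.
by rewrite [gint _ (fun=> k x)]gintc// gint_setT1 mulr1 gintT.
Qed.

Let stein1E x : f x * phi x = B x * (1 - Phi x) - A x * Phi x.
Proof.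
rewrite divfK ?phi_neq0//.
have -> : (fun t => k t - m) = (fun t => (k t - k x) - (A x + B x)).
  by apply/funext => t; rewrite ABE; ring.
rewrite gintB//; last exact: quad_growthB.
by rewrite -/(B x) gintc// -/(Phi x); ring.
Qed.

Let dstein1E x : f' x * phi x = - (A x * psim x + B x * psip x).
Proof.
rewrite /dstein1 mulrDl -mulrA stein1E -[k x - m]opprB -ABE /psim /psip; ring.
Qed.

Let A_le x : `|A x| <= psip x.
Proof.
rewrite -gint_above_psip; apply: le_norm_gint => //; try exact: quad_growthB.
  by apply: quad_growthB; [exact: quad_growth_id|exact: qc].
move=> t /=; rewrite in_itv/= andbT => xt.
by rewrite (le_trans (kL _ _))// ger0_norm// subr_ge0 ltW.
Qed.

Let B_le x : `|B x| <= psim x.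
Proof.
rewrite -gint_below_psim; apply: le_norm_gint => //; try exact: quad_growthB.
  by apply: quad_growthB; [exact: qc|exact: quad_growth_id].
move=> t /=; rewrite in_itv/= => xt.
by rewrite (le_trans (kL _ _))// distrC ger0_norm// subr_ge0.
Qed.

(** Once [A] and [B] are replaced by their bounds, the weights recombine exactly: psim (1 - Phi) +
    psip Phi = phi. *)
Lemma stein1_le1 x : `|f x| <= 1.
Proof.
rewrite -(ler_pM2r (phi_gt0 x)) mul1r -{1}(ger0_norm (phi_ge0 x)) -normrM.
rewrite stein1E (le_trans (ler_normB _ _))// !normrM.
have P0 := Phi_ge0 x; have P1 := Phi_le1 x.
rewrite (ger0_norm P0) [`|1 - _|]ger0_norm ?subr_ge0//.
apply: (@le_trans _ _ (psim x * (1 - Phi x) + psip x * Phi x)).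
  by apply: lerD; rewrite ler_wpM2r// subr_ge0.
by rewrite /psim /psip; lra.
Qed.

(** A supporting line of slope l at [x] gives A >= l psip and B >= - l psim; in A psim + B psip the
    two bounds cancel. *)
Lemma dstein1_le0 x : f' x <= 0.
Proof.
rewrite -(pmulr_lle0 _ (phi_gt0 x)) dstein1E oppr_le0.
have [l kl] := ksub x.
have q1 : quad_growth (fun t : R => l * (t - x)).
  by apply: quad_growthZ; apply: quad_growthB; [exact: quad_growth_id|exact: qc].
have Al : l * psip x <= A x.
  rewrite -gint_above_psip -gintZ//; last first.
    by apply: quad_growthB; [exact: quad_growth_id|exact: qc].
  apply: le_gint => //; first exact: quad_growthB.
  by move=> t _; rewrite lerBrDl.
have Bl : - l * psim x <= B x.
  rewrite -gint_below_psim -gintZ//; last first.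
    by apply: quad_growthB; [exact: qc|exact: quad_growth_id].
  have -> : (fun t => - l * (x - t)) = (fun t => l * (t - x)).
    by apply/funext => t; ring.
  apply: le_gint => //; first exact: quad_growthB.
  by move=> t _; rewrite lerBrDl.
have := ler_wpM2r (psim_ge0 x) Al; have := ler_wpM2r (psip_ge0 x) Bl.
lra.
Qed.

(** With [A] below [psip] and [B] below [psim], the combination A psim + B psip is at most twice the
    product psip psim. *)
Lemma dstein1_ge x : - (2 * phi 0) <= f' x.
Proof.
rewrite -(ler_pM2r (phi_gt0 x)) dstein1E mulNr lerN2.
have /ler_normlP[_ Ax] := A_le x; have /ler_normlP[_ Bx] := B_le x.
have := ler_wpM2r (psim_ge0 x) Ax; have := ler_wpM2r (psip_ge0 x) Bx.
by have := psip_psim_le x; lra.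
Qed.

(** The coefficients of [A] and [B] are second moments of one-sided parts, hence of constant sign;
    weighted by [psip] and [psim] they again add up to exactly [phi]. *)
Let der_mul_le1 x : `|f x + x * f' x| <= 1.
Proof.
rewrite -(ler_pM2r (phi_gt0 x)) mul1r -{1}(ger0_norm (phi_ge0 x)) -normrM.
rewrite mulrDl -[x * _ * _]mulrA stein1E dstein1E.
have M1 := second_moment_above_ge0 x; have M2 := second_moment_below_ge0 x.
rewrite [X in `|X|](_ : _ = B x * ((1 + x ^+ 2) * (1 - Phi x) - x * phi x) -
    A x * ((1 + x ^+ 2) * Phi x + x * phi x)); last first.
  by rewrite /psim /psip; ring.
rewrite (le_trans (ler_normB _ _))// !normrM (ger0_norm M1) (ger0_norm M2).
apply: le_trans (_ : _ <= psim x * ((1 + x ^+ 2) * (1 - Phi x) - x * phi x) +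
    psip x * ((1 + x ^+ 2) * Phi x + x * phi x)) _.
  by apply: lerD; rewrite ler_wpM2r.
by rewrite /psim /psip; lra.
Qed.

(* [f' = x f + k - m], where [x f] has derivative [f + x f'] *)
Lemma dstein1_lipschitz x y : `|f' x - f' y| <= 2 * `|x - y|.
Proof.
have dM (t : R) : is_derive t 1 (fun t => t * f t) (f t + t * f' t).
  by apply: (derE (derM (derid t) (der_stein1 t))); rewrite mul1r.
have := lipschitz_der dM der_mul_le1 x y; rewrite mul1r => xf.
rewrite /dstein1 (_ : _ - _ = (x * f x - y * f y) + (k x - k y)); last by ring.
by rewrite (le_trans (ler_normD _ _))// mulr2n mulrDl mul1r lerD.
Qed.

Lemma dstein1_continuous : continuous f'.
Proof.
move=> x; apply: cvgD.
  by apply: cvgM; [exact: cvg_id|exact: der_continuous (der_stein1 x)].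
by apply: cvgB; [exact: lipschitz1_continuous|exact: cvg_cst].
Qed.

End standard_stein_equation.

(** * Supporting lines of a convex function *)

Section convex_lipschitz.
Context {R : realType}.
Variable h : R -> R.
Hypothesis h_convex : convex_function [set: R^o] h.

Let convexE (t x y : R) : 0 <= t -> t <= 1 ->
  h (t * x + (1 - t) * y) <= t * h x + (1 - t) * h y.
Proof.
move=> t0 t1; have := h_convex (Itv01 t0 t1) (in_setT x) (in_setT y).
by rewrite !convRE.
Qed.

Lemma convex_slope (a x b : R) : a < x -> x < b ->
  (h x - h a) / (x - a) <= (h b - h x) / (b - x).
Proof.
move=> ax xb; have ab := lt_trans ax xb.
have xa0 : 0 < x - a by rewrite subr_gt0.
have bx0 : 0 < b - x by rewrite subr_gt0.
have ba0 : 0 < b - a by rewrite subr_gt0.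
have t0 : 0 <= (b - x) / (b - a) by rewrite divr_ge0 ?ltW.
have t1 : (b - x) / (b - a) <= 1 by rewrite ler_pdivrMr// mul1r lerB// ltW.
have := convexE a b t0 t1.
have -> : (b - x) / (b - a) * a + (1 - (b - x) / (b - a)) * b = x.
  by field; rewrite gt_eqF.
rewrite -(ler_pM2r ba0).
have -> : ((b - x) / (b - a) * h a + (1 - (b - x) / (b - a)) * h b) * (b - a) =
  (b - x) * h a + (x - a) * h b by field; rewrite gt_eqF.
rewrite ler_pdivrMr// mulrAC ler_pdivlMr//.
lra.
Qed.

(** The slope is the supremum of the difference quotients on the left, finite because each quotient
    on the right bounds them. Convexity enters the estimates in this form, which is stable under
    affine changes of variable. *)
Lemma convex_subgradient (x : R) : exists l, forall y, h x + l * (y - x) <= h y.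
Proof.
pose S := [set s | exists2 a, a < x & s = (h x - h a) / (x - a)].
have S0 : S !=set0 by eexists; exists (x - 1); rewrite ?ltrBlDr ?ltrDl.
have Sub b : x < b -> ubound S ((h b - h x) / (b - x)).
  by move=> xb _ [a ax ->]; exact: convex_slope.
have supS : has_sup S.
  by split => //; eexists; apply: (Sub (x + 1)); rewrite ltrDl.
exists (sup S) => y; have [yx|xy|->] := ltgtP y x.
- have : (h x - h y) / (x - y) <= sup S by apply: sup_upper_bound => //; exists y.
  by rewrite ler_pdivrMr ?subr_gt0//; lra.
- have : sup S <= (h y - h x) / (y - x) by apply: ge_sup => //; exact: Sub.
  by rewrite ler_pdivlMr ?subr_gt0//; lra.
- by rewrite subrr mulr0 addr0.
Qed.

End convex_lipschitz.

(** * Stein's equation with mean [mu] and standard deviation [sigma] *)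

Section stein_equation.
Context {R : realType}.
Notation phi := (@phi R).
Implicit Type x : R.

(** With x = mu + sigma y, the function y |-> f (mu + sigma y) solves the normalised equation for
    this payoff. Dividing by sigma compensates the dilation, so the payoff stays 1-Lipschitz; f is
    not rescaled, while f' picks up one factor 1 / sigma. *)
Definition std_payoff (mu sigma : R) (h : R -> R) (y : R) : R :=
  h (mu + sigma * y) / sigma.

Definition stein_sol (mu sigma : R) (h : R -> R) x : R :=
  stein1 (std_payoff mu sigma h) ((x - mu) / sigma).

Definition dstein_sol (mu sigma : R) (h : R -> R) x : R :=
  dstein1 (std_payoff mu sigma h) ((x - mu) / sigma) / sigma.

Variable h : R -> R.
Hypothesis hL : forall x y, `|h x - h y| <= `|x - y|.
Hypothesis hsub : forall x, exists l, forall y, h x + l * (y - x) <= h y.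

Lemma quad_growth_payoff (mu tau : R) : quad_growth (fun z => h (mu + tau * z)).
Proof.
have [mh _] := lipschitz1_quad_growth hL.
split.
  by apply: (measurableT_comp mh); apply: measurable_funD.
have [_ [c ct]] := @quad_growth_id R.
exists (`|h mu| + `|tau| * c) => t.
have := hL (mu + tau * t) mu; rewrite addrAC subrr add0r normrM => ht.
rewrite mulrDl -[h (mu + _)](subrK (h mu)) addrC (le_trans (ler_normD _ _))// lerD//.
  by rewrite ler_peMr// lerDl sqr_ge0.
by rewrite (le_trans ht)// -mulrA ler_wpM2l.
Qed.

Variables (mu sigma : R).
Hypothesis s0 : 0 < sigma.
Notation k := (std_payoff mu sigma h).
Notation f := (stein_sol mu sigma h).
Notation f' := (dstein_sol mu sigma h).

Let sn0 : sigma != 0. Proof. exact: lt0r_neq0. Qed.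

Let kL x y : `|k x - k y| <= `|x - y|.
Proof.
rewrite /std_payoff -mulrBl normrM normfV (gtr0_norm s0) ler_pdivrMr//.
rewrite (le_trans (hL _ _))// -[sigma in leRHS]gtr0_norm// -normrM.
by rewrite (_ : _ - _ = (x - y) * sigma)//; ring.
Qed.

Let ksub x : exists l, forall y, k x + l * (y - x) <= k y.
Proof.
have [l hl] := hsub (mu + sigma * x); exists l => y.
rewrite /std_payoff ler_pdivlMr// mulrDl divfK//.
apply: le_trans (hl (mu + sigma * y)).
by rewrite lerD2l le_eqVlt; apply/orP; left; apply/eqP; ring.
Qed.

Lemma der_stein_sol (x : R) : is_derive x 1 f (f' x).
Proof.
rewrite /stein_sol /dstein_sol.
apply: (derE (dercomp (derM (derB (derid x) (derC mu x)) (derC sigma^-1 x))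
  (der_stein1 kL ((x - mu) / sigma)))).
by rewrite subr0 mul1r mulr0 addr0.
Qed.

Lemma stein_sol_eq x : sigma ^+ 2 * f' x - (x - mu) * f x =
  h x - gaussian_expectation (fun z => h (mu + sigma * z)).
Proof.
have -> : gaussian_expectation (fun z => h (mu + sigma * z)) =
    sigma * gaussian_expectation k.
  rewrite -!gintT; [|exact: lipschitz1_quad_growth|exact: quad_growth_payoff].
  rewrite -gintZ//; last exact: lipschitz1_quad_growth.
  by congr gint; apply/funext => z; rewrite /std_payoff [RHS]mulrC divfK.
rewrite /f' /dstein1 {2}/std_payoff (_ : mu + sigma * ((x - mu) / sigma) = x).
  by rewrite /stein_sol; field.
by field.
Qed.

Lemma stein_sol_le1 x : `|f x| <= 1.
Proof. exact: stein1_le1. Qed.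

Lemma dstein_sol_le0 x : f' x <= 0.
Proof. by rewrite ler_pdivrMr// mul0r; exact: dstein1_le0. Qed.

Lemma dstein_sol_ge x : - f' x <= Num.sqrt (2 / pi) / sigma.
Proof.
rewrite -two_phi0 lerNl -mulNr ler_pM2r ?invr_gt0//; exact: dstein1_ge.
Qed.

Lemma dstein_sol_lipschitz x y : `|f' x - f' y| <= 2 / sigma ^+ 2 * `|x - y|.
Proof.
rewrite -mulrBl normrM normfV (gtr0_norm s0) ler_pdivrMr//.
rewrite (le_trans (dstein1_lipschitz kL _ _))//.
rewrite -mulrBl opprB addrA subrK normrM normfV (gtr0_norm s0).
by rewrite le_eqVlt; apply/orP; left; apply/eqP; field.
Qed.

Lemma dstein_sol_continuous : continuous f'.
Proof.
move=> x; apply: cvgM; last exact: cvg_cst.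
apply: (@continuous_comp _ _ _ (fun x => (x - mu) / sigma) (dstein1 k)).
  exact: der_continuous.
exact: dstein1_continuous.
Qed.

(* For two bounded solutions, [(f - g)(mu + sigma y) phi(y)] is constant and
   vanishes at infinity. *)
Lemma stein_solutionE : stein_solution mu sigma h = f.
Proof.
have fS : is_stein_solution mu sigma h f.
  split.
    exists 1; split => // M M1 x _; exact: le_trans (stein_sol_le1 x) (ltW M1).
  move=> x; have [dx Ex] := der_stein_sol x; split => //.
  by rewrite Ex stein_sol_eq.
(* As [f] witnesses existence, the function selected by [xget] is a solution and not the default
   value. *)
have [[M [_ gM]] gS] : is_stein_solution mu sigma h (stein_solution mu sigma h).
  exact: (@xgetPex _ (fun=> 0) [set f | is_stein_solution mu sigma h f] (ex_intro _ f fS)).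
set g := stein_solution mu sigma h in gM gS *.
pose u y := (g (mu + sigma * y) - f (mu + sigma * y)) * phi y.
have du (y : R) : is_derive y 1 u 0.
  have dg : is_derive (mu + sigma * y) 1 g ('D_1 g (mu + sigma * y)).
    by apply: derivableP; exact: (gS _).1.
  have da : is_derive y 1 (fun y => mu + sigma * y) sigma.
    apply: (derE (derD (derC mu y) (derM (derC sigma y) (derid y)))).
    by rewrite mul0r mulr1 !add0r.
  apply: (derE (derM (derB (dercomp da dg)
     (dercomp da (der_stein_sol (mu + sigma * y)))) (der_phi y))).
  have := (gS (mu + sigma * y)).2; have := stein_sol_eq (mu + sigma * y).
  set G := g _; set F := f _; set G' := 'D_1 g _; set F' := f' _ => <-.
  rewrite addrAC subrr add0r => e.
  apply: (mulfI sn0); rewrite mulr0.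
  rewrite [LHS](_ : _ = ((sigma ^+ 2 * G' - sigma * y * G) -
    (sigma ^+ 2 * F' - sigma * y * F)) * phi y); last by ring.
  by rewrite e subrr mul0r.
apply/funext => x; apply/eqP; rewrite -subr_eq0.
have uE z : u z = u ((x - mu) / sigma) by exact: is_derive_0_is_cst.
have -> : (g x - f x == 0) = (u ((x - mu) / sigma) == 0).
  rewrite /u mulf_eq0 (negbTE (phi_neq0 _)) orbF.
  by rewrite mulrC divfK// subrKC.
have gM1 z : `|g z| <= `|M| + 1.
  by apply: (gM (`|M| + 1)) => //; rewrite (le_lt_trans (ler_norm M))// ltrDl.
have uM n : `|u ((x - mu) / sigma)| <= (`|M| + 1 + 1) * phi n%:R.
  rewrite -(uE n%:R) normrM (ger0_norm (phi_ge0 _)) ler_wpM2r ?phi_ge0//.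
  by rewrite (le_trans (ler_normB _ _))// lerD// stein_sol_le1.
rewrite -normr_le0.
have lim : (`|M| + 1 + 1) * phi n%:R @[n --> \oo] --> (`|M| + 1 + 1) * 0.
  by apply: cvgM; [exact: cvg_cst|exact: cvg_phi].
rewrite mulr0 in lim; rewrite -[leRHS](cvg_lim _ lim)//; apply: limr_ge.
- by apply/cvg_ex; exists 0.
- exact: nearW.
Qed.

End stein_equation.

(** * One round of the algorithm *)

Section taylor_lipschitz.
Context {R : realType}.

(** As [dF] is only Lipschitz, there is no second derivative to bound; instead the gap [u] between
    the bound and the remainder vanishes at 0 and has nonnegative derivative on the positive
    axis. *)
Let taylor_ub (F dF : R -> R) (L y g : R) : (forall x : R, is_derive x 1 F (dF x)) ->
  (forall x z, `|dF x - dF z| <= L * `|x - z|) -> 0 <= g ->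
  F (y + g) - F y - g * dF y <= L / 2 * g ^+ 2.
Proof.
move=> dFE dFL g0; rewrite -subr_ge0.
pose u t := L / 2 * (t * t) - (F (y + t) - F y - t * dF y).
have dy (t : R) : is_derive t 1 (fun t => y + t) 1.
  by apply: (derE (derD (derC y t) (derid t))); rewrite add0r.
have du (t : R) : is_derive t 1 u (L * t - (dF (y + t) - dF y)).
  apply: (derE (derB (derM (derC (L / 2) t) (derM (derid t) (derid t)))
    (derB (derB (dercomp (dy t) (dFE (y + t))) (derC (F y) t))
      (derM (derid t) (derC (dF y) t))))).
  by field.
have := nondecreasing_der g0 du.
rewrite {1}/u !mul0r mulr0 addr0 !subrr /u expr2; apply => t /andP[t0 _].
rewrite subr_ge0 (le_trans (ler_norm _))// (le_trans (dFL _ _))//.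
by rewrite addrAC subrr add0r ger0_norm.
Qed.

(** The one-sided bound is applied to - F for the lower estimate, and to x |-> F (- x) for negative
    [g]. *)
Lemma taylor_lipschitz (F dF : R -> R) (L y g : R) :
  (forall x : R, is_derive x 1 F (dF x)) ->
  (forall x z, `|dF x - dF z| <= L * `|x - z|) ->
  `|F (y + g) - F y - g * dF y| <= L / 2 * g ^+ 2.
Proof.
move=> dFE dFL.
have NL x z : `|- dF x - - dF z| <= L * `|x - z|.
  by rewrite -opprD normrN; exact: dFL.
have pos (G dG : R -> R) z r : (forall x : R, is_derive x 1 G (dG x)) ->
    (forall x y, `|dG x - dG y| <= L * `|x - y|) -> 0 <= r ->
    `|G (z + r) - G z - r * dG z| <= L / 2 * r ^+ 2.
  move=> dGE dGL r0; rewrite ler_norml; apply/andP; split; last exact: taylor_ub.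
  rewrite lerNl.
  have := @taylor_ub (fun x => - G x) (fun x => - dG x) L z r
    (fun x => derN (dGE x)) _ r0.
  rewrite !opprD !opprK mulrN opprK; apply=> x w.
  by rewrite -opprD normrN; exact: dGL.
have [g0|g0] := leP 0 g; first exact: pos.
have Ng0 : 0 <= - g by rewrite oppr_ge0 ltW.
have dN (x : R) : is_derive x 1 (fun x => F (- x)) (- dF (- x)).
  by apply: (derE (dercomp (derN (derid x)) (dFE (- x)))); rewrite mulrN1.
have := pos (fun x => F (- x)) _ (- y) (- g) dN _ Ng0.
rewrite -opprD !opprK sqrrN mulrN mulNr opprK; apply => x z.
by rewrite (le_trans (NL _ _))// -opprD normrN.
Qed.

End taylor_lipschitz.

Section stein_round.
Context {R : realType}.
Notation phi := (@phi R).

(** For [G := h] this is the function H of the overview; for [G] the Stein solution with mean [c] it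
    is the output of the algorithm. *)
Definition smooth (G : R -> R) (c tau : R) : R :=
  gaussian_expectation (fun z => G (c + tau * z)).

Variable h : R -> R.
Hypothesis hL : forall x y, `|h x - h y| <= `|x - y|.

Let qc (c : R) : quad_growth (fun=> c * 1 : R).
Proof. exact: quad_growth_cst. Qed.

Let gc (c : R) : gint setT (fun=> c * 1) = c.
Proof. by rewrite gintZ// ?gint_setT1 ?mulr1//; exact: quad_growth_cst. Qed.

Lemma smooth_lipschitz (a b tau : R) :
  `|smooth h a tau - smooth h b tau| <= `|a - b|.
Proof.
have q c := quad_growth_payoff hL c tau.
rewrite /smooth -!gintT// -gintB//.
rewrite (le_trans (@le_norm_gint _ setT _ (fun=> `|a - b| * 1) _ _ _ _))//.
- exact: quad_growthB.
- move=> z _; rewrite mulr1 (le_trans (hL _ _))//.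
  by rewrite [X in `|X|](_ : _ = a - b)//; ring.
- by rewrite gc.
Qed.

(** The bound does not depend on the centre [c]; this makes the cost of lowering the noise level
    uniform over the losses. *)
Lemma smooth_dist (c s tau : R) :
  `|smooth h c s - smooth h c tau| <= `|s - tau| * gaussian_expectation (fun z => `|z|).
Proof.
have q t := quad_growth_payoff hL c t.
have qn : quad_growth (fun z : R => `|z|).
  have [_ [k kt]] := @quad_growth_id R; split; first exact: normr_measurable.
  by exists k => t; rewrite normr_id.
rewrite /smooth -!gintT// -gintB// -gintZ//.
apply: le_norm_gint => //; [exact: quad_growthB|exact: quad_growthZ|].
move=> z _; rewrite (le_trans (hL _ _))// -normrM.
by rewrite [X in `|X|](_ : _ = (s - tau) * z)//; ring.
Qed.

Hypothesis hsub : forall x, exists l, forall y, h x + l * (y - x) <= h y.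
Variables (mu sigma tau : R).
Hypothesis s0 : 0 < sigma.
Notation f := (stein_sol mu sigma h).
Notation f' := (dstein_sol mu sigma h).

Let f'le x : `|f' x| <= Num.sqrt (2 / pi) / sigma.
Proof. by rewrite ler0_norm; [exact: dstein_sol_ge|exact: dstein_sol_le0]. Qed.

Let aff_cont (c : R) : continuous (fun z => c + tau * z).
Proof. by move=> z; exact: der_continuous. Qed.

Let fcont : continuous f.
Proof. by move=> z; exact: der_continuous (der_stein_sol hL mu s0 z). Qed.

Let f_aff_cont c : continuous (fun z => f (c + tau * z)).
Proof.
move=> z; apply: (@continuous_comp _ _ _ (fun z => c + tau * z) f).
  exact: aff_cont.
exact: fcont.
Qed.

Let f'_aff_cont c : continuous (fun z => f' (c + tau * z)).
Proof.
move=> z; apply: (@continuous_comp _ _ _ (fun z => c + tau * z) f').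
  exact: aff_cont.
exact: dstein_sol_continuous.
Qed.

Let qf c : quad_growth (fun z => f (c + tau * z)).
Proof.
apply: quad_growth_bounded (continuous_measurable_fun (@f_aff_cont c)) _.
by move=> z; exact: stein_sol_le1.
Qed.

Let qf' c : quad_growth (fun z => f' (c + tau * z)).
Proof.
exact: quad_growth_bounded (continuous_measurable_fun (@f'_aff_cont c)) _.
Qed.

Let qzf c : quad_growth (fun z => z * f (c + tau * z)).
Proof.
apply: quad_growth_idM (continuous_measurable_fun (@f_aff_cont c)) _.
by move=> z; exact: stein_sol_le1.
Qed.

(** The difference of the two integrands, times [phi], is up to sign the derivative of f (c + tau z)
    phi z, which vanishes at both infinities since f is bounded. *)
Lemma gaussian_integration_by_parts c :
  gint setT (fun z => z * f (c + tau * z)) = tau * gint setT (fun z => f' (c + tau * z)).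
Proof.
have q : quad_growth (fun z => tau * f' (c + tau * z) - z * f (c + tau * z)).
  by apply: quad_growthB => //; exact: quad_growthZ.
have da (z : R) : is_derive z 1 (fun z => c + tau * z) tau.
  apply: (derE (derD (derC c z) (derM (derC tau z) (derid z)))).
  by rewrite mul0r mulr1 !add0r.
have [||z|_ /eqP] := @gint_below_der R (fun z => f (c + tau * z) * phi z) _ 1 q.
- move=> z; apply: cvgB; apply: cvgM; try exact: cvg_cst; try exact: cvg_id.
    exact: f'_aff_cont.
  exact: f_aff_cont.
- move=> z; apply: (derE (derM (dercomp (da z) (der_stein_sol hL mu s0 (c + tau * z)))
    (der_phi z))).
  by ring.
- rewrite mul1r normrM (ger0_norm (phi_ge0 _)) ler_wpM2r ?phi_ge0//.
  by rewrite (le_trans (stein_sol_le1 hL mu s0 _))// lerDl.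
by rewrite gintB// ?gintZ//; [rewrite subr_eq0 => /eqP|exact: quad_growthZ].
Qed.

Lemma stein_round_identity (g : R) :
  smooth h (mu + g) tau - smooth h mu sigma =
  (sigma ^+ 2 - tau ^+ 2) * smooth f' (mu + g) tau - g * smooth f (mu + g) tau.
Proof.
have q := quad_growth_payoff hL (mu + g) tau.
have q0 := quad_growth_payoff hL mu sigma.
rewrite /smooth -!gintT//.
rewrite -[X in _ - X = _]gc -gintB//.
have -> : (fun z => h (mu + g + tau * z) - gint setT (fun z => h (mu + sigma * z)) * 1)
   = fun z => sigma ^+ 2 * f' (mu + g + tau * z) - (g * f (mu + g + tau * z)
       + tau * (z * f (mu + g + tau * z))).
  apply/funext => z; rewrite mulr1 gintT; last exact: quad_growth_payoff.
  by rewrite -stein_sol_eq//; ring.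
have q1 := quad_growthZ tau (@qzf (mu + g)).
have q2 := quad_growthZ g (@qf (mu + g)).
rewrite gintB// ?gintD// ?gintZ//; [|exact: quad_growthZ|exact: quad_growthD].
by rewrite gaussian_integration_by_parts; ring.
Qed.

Lemma smooth_stein_sol_le1 c : `|smooth f c tau| <= 1.
Proof.
rewrite /smooth -gintT// -[leRHS](@gint_setT1 R).
apply: le_norm_gint => //; first exact: quad_growth_cst.
by move=> z _; exact: stein_sol_le1.
Qed.

Lemma smooth_dstein_sol_le0 c : smooth f' c tau <= 0.
Proof.
rewrite /smooth -gintT// -oppr_ge0 -mulN1r -gintZ//; apply: gint_ge0 => z _.
by rewrite mulN1r oppr_ge0 dstein_sol_le0.
Qed.

Lemma smooth_dstein_sol_ge c : - smooth f' c tau <= Num.sqrt (2 / pi) / sigma.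
Proof.
rewrite /smooth -gintT// -mulN1r -gintZ// -[leRHS]gc.
apply: le_gint => //; first exact: quad_growthZ.
by move=> z _; rewrite mulN1r mulr1; exact: dstein_sol_ge.
Qed.

(** The two error terms have separate origins. Moving the argument of f' back from mu + g to mu
    costs 2 |g| / sigma^2, multiplied by the budget. The first-order expansion of f leaves g^2 /
    sigma^2, half the Lipschitz constant of f' times g^2, multiplied by |g|. *)
Lemma stein_round (g : R) : 0 <= tau <= sigma ->
  g * smooth f mu tau <=
  - smooth h (mu + g) tau + smooth h mu sigma
  + (g ^+ 2 - (sigma ^+ 2 - tau ^+ 2)) * (- smooth f' mu tau)
  + (2 * (sigma ^+ 2 - tau ^+ 2) * `|g| + `|g ^+ 3|) / sigma ^+ 2.
Proof.
move=> /andP[t0 ts].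
have id := stein_round_identity g.
have C0 : 0 <= sigma ^+ 2 - tau ^+ 2.
  by rewrite subr_ge0 ler_sqr// nnegrE ltW.
have arg z : mu + g + tau * z = mu + tau * z + g by rewrite addrAC.
have T1 : `|smooth f' (mu + g) tau - smooth f' mu tau| <= 2 / sigma ^+ 2 * `|g|.
  rewrite /smooth -!gintT// -gintB// -[leRHS]gc.
  apply: le_norm_gint => //; first exact: quad_growthB.
  move=> z _; rewrite mulr1 (le_trans (dstein_sol_lipschitz hL mu s0 _ _))//.
  by rewrite arg addrAC subrr add0r.
have T2 : `|smooth f (mu + g) tau - smooth f mu tau - g * smooth f' mu tau|
    <= 1 / sigma ^+ 2 * g ^+ 2.
  have qg := quad_growthZ g (@qf' mu).
  rewrite /smooth -!gintT// -gintZ// -!gintB//; last exact: quad_growthB.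
  rewrite -[leRHS]gc.
  apply: le_norm_gint => //.
    by apply: quad_growthB => //; exact: quad_growthB.
  move=> z _; rewrite mulr1 arg.
  have := taylor_lipschitz (mu + tau * z) g (der_stein_sol hL mu s0)
    (dstein_sol_lipschitz hL mu s0).
  rewrite (_ : 2 / sigma ^+ 2 / 2 = 1 / sigma ^+ 2)//.
  by field; exact: lt0r_neq0.
move: id T1 T2; set a := smooth f _ _; set b := smooth f _ _.
set c := smooth f' _ _; set d := smooth f' _ _.
set H1 := smooth h _ _; set H2 := smooth h _ _ => id T1 T2.
have h1 : (sigma ^+ 2 - tau ^+ 2) * (c - d) <=
    (sigma ^+ 2 - tau ^+ 2) * (2 / sigma ^+ 2 * `|g|).
  by rewrite ler_wpM2l// (le_trans (ler_norm _)).
have h2 : - (g * (a - b - g * d)) <= `|g| * (1 / sigma ^+ 2 * g ^+ 2).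
  by rewrite (le_trans (ler_norm _))// normrN normrM ler_wpM2l.
have -> : (2 * (sigma ^+ 2 - tau ^+ 2) * `|g| + `|g ^+ 3|) / sigma ^+ 2 =
  (sigma ^+ 2 - tau ^+ 2) * (2 / sigma ^+ 2 * `|g|) +
  `|g| * (1 / sigma ^+ 2 * g ^+ 2).
  rewrite normrX [`|g| ^+ 3]exprS [`|g| ^+ 2]real_normK ?num_real//.
  by field; exact: lt0r_neq0.
lra.
Qed.

End stein_round.

(** * Measurability and conditional expectations *)

Section measurable_parametric.
Context {R : realType} d (Y : measurableType d).
Implicit Types a b : Y -> R.

Lemma measurable_fun_inv_pos a : (forall y, 0 < a y) ->
  measurable_fun setT a -> measurable_fun setT (fun y => (a y)^-1).
Proof.
move=> a0 ma; rewrite (_ : (fun y => _) = fun y => powR (a y) (-1)).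
  exact: (measurableT_comp (measurable_powR (-1))).
by apply/funext => y; rewrite powR_inv1// ltW.
Qed.

(** Tonelli's theorem for the positive and the negative part separately, followed by the measurable
    map [fine]. *)
Lemma measurable_Rintegral_param (m : {sigma_finite_measure set (measurableTypeR R) -> \bar R})
    (g : Y * measurableTypeR R -> R) :
  measurable_fun setT g -> measurable_fun setT (fun y => \int[m]_t g (y, t)).
Proof.
move=> mg; rewrite /Rintegral.
apply: (measurableT_comp (fine_measurable measurableT)).
rewrite (_ : (fun y => _) = fun y => (\int[m]_t ((EFin \o g)^\+ (y, t)) -
    \int[m]_t ((EFin \o g)^\- (y, t)))%E).
  apply: emeasurable_funB.
    apply: (measurable_fun_fubini_tonelli_F (m2 := m)) => //.
    exact/measurable_funepos/measurable_EFinP.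
  apply: (measurable_fun_fubini_tonelli_F (m2 := m)) => //.
  exact/measurable_funeneg/measurable_EFinP.
apply/funext => y; rewrite [LHS]integralE; congr (_ - _)%E.
  by apply: eq_integral => t _; rewrite !funeposE.
by apply: eq_integral => t _; rewrite !funenegE.
Qed.

Lemma measurable_gaussian_expectation (g : Y * measurableTypeR R -> R) :
  measurable_fun setT g ->
  measurable_fun setT (fun y => gaussian_expectation (fun z => g (y, z))).
Proof. exact: (measurable_Rintegral_param (normal_prob (0 : R) 1)). Qed.

End measurable_parametric.

Section measurable_stein.
Context {R : realType}.
Variable h : R -> R.
Hypothesis mh : measurable_fun setT h.

Lemma measurable_smooth_payoff d (Y : measurableType d) (c tau : Y -> R) :
  measurable_fun setT c -> measurable_fun setT tau ->
  measurable_fun setT (fun y => smooth h (c y) (tau y)).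
Proof.
move=> mc mt.
apply: (@measurable_gaussian_expectation _ _ _ (fun yz => h (c yz.1 + tau yz.1 * yz.2))).
apply: (measurableT_comp mh); apply: measurable_funD.
  exact: (measurableT_comp mc).
by apply: measurable_funM => //; exact: (measurableT_comp mt).
Qed.

(** The domain [Y] is arbitrary so that the statements of this section serve both for the full
    sigma-algebra of the loss space and for F_{t-1}, as well as on products with the Gaussian
    variable. *)
Lemma measurable_stein_sol d (Y : measurableType d) (m s x : Y -> R) :
  (forall y, 0 < s y) ->
  measurable_fun setT m -> measurable_fun setT s -> measurable_fun setT x ->
  measurable_fun setT (fun y => stein_sol (m y) (s y) h (x y)).
Proof.
move=> s0 mm ms mx; have mV := measurable_fun_inv_pos s0 ms.
have mp d' (Z : measurableType d') (c : Z -> Y) (t : Z -> R) :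
    measurable_fun setT c -> measurable_fun setT t ->
    measurable_fun setT (fun z => std_payoff (m (c z)) (s (c z)) h (t z)).
  move=> mc mt; apply: measurable_funM; last exact: (measurableT_comp mV).
  apply: (measurableT_comp mh); apply: measurable_funD.
    exact: (measurableT_comp mm).
  by apply: measurable_funM => //; exact: (measurableT_comp ms).
have my : measurable_fun setT (fun y => (x y - m y) / s y).
  by apply: measurable_funM => //; exact: measurable_funB.
apply: measurable_funM; last first.
  apply: measurable_fun_inv_pos => [y|]; first exact: phi_gt0.
  exact: (measurableT_comp (@measurable_phi R)).
pose m' y := gaussian_expectation (std_payoff (m y) (s y) h).
have mm' : measurable_fun setT m'.
  apply: (@measurable_gaussian_expectation _ _ _
    (fun yz => std_payoff (m yz.1) (s yz.1) h yz.2)).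
  exact: mp.
(* The half-line of integration moves with [y]; turning it into a condition inside the integrand
   leaves an integral over a fixed domain. *)
rewrite (_ : (fun y => _) = fun y => \int[lebesgue_measure]_t
    (if t <= (x y - m y) / s y
     then (std_payoff (m y) (s y) h t - m' y) * phi t else 0)).
  apply: (@measurable_Rintegral_param _ _ _ _
    (fun yt => if yt.2 <= (x yt.1 - m yt.1) / s yt.1
     then (std_payoff (m yt.1) (s yt.1) h yt.2 - m' yt.1) * phi yt.2 else 0)).
  apply: measurable_fun_ifT => //.
    by apply: measurable_fun_ler => //; exact: (measurableT_comp my).
  apply: measurable_funM.
    by apply: measurable_funB; [exact: mp|exact: (measurableT_comp mm')].
  exact: (measurableT_comp (@measurable_phi R)).
apply/funext => y; rewrite /gint Rintegral_mkcond; apply: eq_Rintegral => t _.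
rewrite patchE; case: ifPn => [/set_mem|/negP tn]; first by rewrite /= in_itv/= => ->.
by case: ifPn => // ty; exfalso; apply: tn; rewrite mem_set//= in_itv.
Qed.

Lemma measurable_smooth_stein_sol d (Y : measurableType d) (m s tau : Y -> R) :
  (forall y, 0 < s y) ->
  measurable_fun setT m -> measurable_fun setT s -> measurable_fun setT tau ->
  measurable_fun setT (fun y => smooth (stein_sol (m y) (s y) h) (m y) (tau y)).
Proof.
move=> s0 mm ms mt.
apply: (@measurable_gaussian_expectation _ _ _ (fun yz =>
  stein_sol (m yz.1) (s yz.1) h (m yz.1 + tau yz.1 * yz.2))).
apply: (@measurable_stein_sol _ _ (m \o fst) (s \o fst)) => [y| | |].
- exact: s0.
- exact: (measurableT_comp mm).
- exact: (measurableT_comp ms).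
- apply: measurable_funD; first exact: (measurableT_comp mm).
  by apply: measurable_funM => //; exact: (measurableT_comp mt).
Qed.

Hypothesis hL : forall x y, `|h x - h y| <= `|x - y|.

Lemma measurable_smooth_dstein_sol d (Y : measurableType d) (m s tau : Y -> R) :
  (forall y, 0 < s y) ->
  measurable_fun setT m -> measurable_fun setT s -> measurable_fun setT tau ->
  measurable_fun setT (fun y => smooth (dstein_sol (m y) (s y) h) (m y) (tau y)).
Proof.
move=> s0 mm ms mt; have mV := measurable_fun_inv_pos s0 ms.
(* Stein's equation solved for f', which reduces its measurability to that of f and h. *)
have E y x : dstein_sol (m y) (s y) h x =
  ((x - m y) * stein_sol (m y) (s y) h x + (h x - smooth h (m y) (s y)))
    * ((s y)^-1 * (s y)^-1).
  have := stein_sol_eq hL (m y) (s0 y) x; rewrite -/(smooth h (m y) (s y)) => <-.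
  by field; exact: lt0r_neq0.
apply: (@measurable_gaussian_expectation _ _ _ (fun yz =>
  dstein_sol (m yz.1) (s yz.1) h (m yz.1 + tau yz.1 * yz.2))).
under eq_fun do rewrite E.
have m1 (a : Y -> R) : measurable_fun setT a ->
    measurable_fun [set: Y * measurableTypeR R] (a \o fst).
  by move=> ma; exact: (measurableT_comp ma).
have mx : measurable_fun [set: Y * measurableTypeR R]
    (fun yz => m yz.1 + tau yz.1 * yz.2).
  by apply: measurable_funD; [exact: m1|apply: measurable_funM => //; exact: m1].
apply: measurable_funM; last exact: (measurable_funM (m1 _ mV) (m1 _ mV)).
apply: measurable_funD.
  apply: measurable_funM; first by apply: measurable_funB => //; exact: m1.
  apply: (@measurable_stein_sol _ _ (m \o fst) (s \o fst)) => [y| | |//].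
  - exact: s0.
  - exact: m1.
  - exact: m1.
apply: measurable_funB; first exact: (measurableT_comp mh).
by apply: (@measurable_smooth_payoff _ _ (m \o fst) (s \o fst)); exact: m1.
Qed.

End measurable_stein.

(** Dropping the negative part of [f] only increases its integral, and the positive part lies below
    the nonnegative [g]. *)
Lemma le_integral_ge0r d (Omega : measurableType d) (R : realType)
    (m : {measure set Omega -> \bar R}) (f g : Omega -> \bar R) :
  measurable_fun setT f -> measurable_fun setT g ->
  (forall w, 0 <= g w)%E -> (forall w, f w <= g w)%E ->
  (\int[m]_w f w <= \int[m]_w g w)%E.
Proof.
move=> mf mg g0 fg; rewrite integralE.
apply: (@le_trans _ _ (\int[m]_w f^\+ w)%E).
  by rewrite -[leRHS]adde0 leeD// leeNl oppe0 integral_ge0.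
apply: ge0_le_integral => //; first exact: measurable_funepos.
by move=> w _; rewrite funeposE ge_max fg g0.
Qed.

Section sub_sigma_algebras.
Context d (Omega : measurableType d).
Implicit Types G : set (set Omega).

(** A sub-sigma-algebra is carried by a change of type of the domain; the identity is the map
    between the two types, here back to the ambient one, and serves as [pr] in
    [le_integral_weight]. *)
Lemma measurable_id_sub G : G `<=` measurable ->
  measurable_fun setT (id : Omega -> g_sigma_algebraType G).
Proof.
move=> Gm; apply: (@measurability _ _ _ (g_sigma_algebraType G) _ _ G) => //.
by move=> _ [A GA <-]; rewrite setTI; exact: Gm.
Qed.

Lemma sub_measurable_funW G d' (U : measurableType d') (f : Omega -> U) :
  G `<=` measurable -> sub_measurable_fun G f -> measurable_fun setT f.
Proof.
move=> Gm mf.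
have := measurableT_comp (mf : measurable_fun [set: g_sigma_algebraType G] _)
  (measurable_id_sub Gm).
exact.
Qed.

Lemma sub_measurable_funS G G' d' (U : measurableType d') (f : Omega -> U) :
  G `<=` G' -> sub_measurable_fun G f -> sub_measurable_fun G' f.
Proof.
move=> GG' mf.
have mid : measurable_fun setT (id : g_sigma_algebraType G' -> g_sigma_algebraType G).
  apply: (@measurability _ _ _ (g_sigma_algebraType G) _ _ G) => //.
  by move=> _ [A GA <-]; rewrite setTI; apply: sub_sigma_algebra; exact: GG'.
have := measurableT_comp (mf : measurable_fun [set: g_sigma_algebraType G] _) mid.
exact.
Qed.

(** On a set of the sub-sigma-algebra the integral of [Y] is that of [V], hence at most that of its
    positive part. The positive part is taken because a version [V] may be negative on a null
    set. *)
Lemma cond_expectation_le (R : realType) (P : probability Omega R) G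
    (Y : Omega -> R) (V : Omega -> \bar R) (W : Omega -> R) :
  G `<=` measurable -> (forall w, 0 <= Y w) -> measurable_fun setT Y ->
  is_cond_expectation P G Y V ->
  sub_measurable_fun G W -> (forall w, 0 <= W w) ->
  (\int[P]_w ((W w)%:E * (Y w)%:E) <= \int[P]_w ((W w)%:E * maxe (V w) 0))%E.
Proof.
move=> Gm Y0 mY [mV VY] mW W0; have mV' := sub_measurable_funW Gm mV.
apply: (@le_integral_weight _ _ _ _ (g_sigma_algebraType G) P P id
  (measurable_id_sub Gm) (fun w => (Y w)%:E) (fun w => maxe (V w) 0%E) W) => //.
- exact/measurable_EFinP.
- by move=> w; rewrite le_max lexx orbT.
- by apply: measurable_maxe.
- move=> A mA; rewrite /= -VY// integralE.
  rewrite -[leRHS]adde0 leeD//.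
    rewrite le_eqVlt; apply/orP; left; apply/eqP.
    by apply: eq_integral => w _; rewrite funeposE.
  by rewrite leeNl oppe0 integral_ge0.
Qed.

End sub_sigma_algebras.

Section loss_filtration.
Context {R : realType} {T : nat}.
Notation Omega := (loss_space R T).

Lemma filtration_gen_measurable k : @filtration_gen R T k `<=` measurable.
Proof.
by move=> A [i _ [B mB <-]]; exact: (measurable_tnth i).
Qed.

Lemma filtration_genS k l : (k <= l)%N ->
  @filtration_gen R T k `<=` @filtration_gen R T l.
Proof.
by move=> kl A [i ik Ai]; exists i => //; exact: leq_trans kl.
Qed.

Lemma measurable_loss i : measurable_fun setT (@loss R T i).
Proof. exact: measurable_tnth. Qed.

Lemma sub_measurable_partial_sum k :
  sub_measurable_fun (@filtration_gen R T k) (@partial_sum R T k).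
Proof.
rewrite /sub_measurable_fun /partial_sum.
under eq_fun do rewrite big_mkcond.
apply: measurable_sum => i; case: (boolP (i < k)%N) => // ik.
move=> _ B mB.
have : @filtration_gen R T k (setT `&` loss i @^-1` B).
  by exists i => //; exists B.
exact: (@sub_sigma_algebra _ setT).
Qed.

Lemma partial_sumS (i : 'I_T) (w : Omega) :
  partial_sum i.+1 w = partial_sum i w + loss i w.
Proof.
rewrite /partial_sum (bigD1 i) ?ltnS//= addrC; congr (_ + _).
apply: eq_bigl => j; rewrite ltnS -(inj_eq val_inj)/=.
by rewrite ltn_neqAle andbC.
Qed.

Lemma partial_sum0 (w : Omega) : partial_sum 0 w = 0.
Proof. by rewrite /partial_sum big_pred0. Qed.

Lemma partial_sumT (w : Omega) : partial_sum T w = \sum_(i < T) loss i w.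
Proof. by rewrite /partial_sum; apply: eq_bigl => i; rewrite ltn_ord. Qed.

End loss_filtration.

(** * Summing over the rounds *)

Section stein_regret.
Context {R : realType} {T : nat}.
Notation Omega := (loss_space R T).
Variable h : R -> R.
Hypothesis hL : forall x y, `|h x - h y| <= `|x - y|.
Hypothesis hsub : forall x, exists l, forall y, h x + l * (y - x) <= h y.
Variables (p0 : R) (p : nat -> Omega -> R).
Hypothesis hp : admissible p0 p.
Variables (P : probability Omega R) (V : 'I_T -> Omega -> \bar R).
Hypothesis hV : forall i : 'I_T, is_cond_expectation P (@filtration_gen R T i)
  (fun w => loss i w ^+ 2) (V i).

(** In the notation of the overview, with t = i + 1: [potential k] is H(S_k, P_k), [budget i] is C_t
    and [weight i] is W_t. *)
Let potential k w := smooth h (partial_sum k w) (p k w).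
Let budget (i : 'I_T) w := variance_budget p i w.
Let weight (i : 'I_T) w :=
  - smooth (dstein_sol (partial_sum i w) (p i w) h) (partial_sum i w) (p i.+1 w).
Let cubic (i : 'I_T) w :=
  (2 * budget i w * `|loss i w| + `|loss i w ^+ 3|) / p i w ^+ 2.
Let drift (i : 'I_T) w :=
  loss i w * stein_algorithm h p i w + (potential i.+1 w - potential i w).
Let absZ : R := gaussian_expectation (fun z => `|z|).

(** Among the parameters only P_T may vanish, and [p i] with [i : 'I_T] is P_{t-1}, whose index is
    below T. *)
Let p_gt0 (i : 'I_T) w : 0 < p i w.
Proof.
have [p00 p0E hpi] := hp; case: i => [[|k] kT]/=; first by rewrite p0E.
have [_ _ pos] := hpi (Ordinal (ltnW kT)); exact: pos.
Qed.

Let p_range (i : 'I_T) w : 0 <= p i.+1 w <= p i w.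
Proof. by have [_ _ hpi] := hp; have [_] := hpi i. Qed.

Let p_le k w : (k <= T)%N -> p k w <= p0.
Proof.
elim: k => [|k ih] kT; first by have [_ p0E _] := hp; rewrite p0E.
have /andP[_] := p_range (Ordinal kT) w.
by move=> /le_trans; apply; exact/ih/ltnW.
Qed.

Let sub_p (i : 'I_T) :
  sub_measurable_fun (@filtration_gen R T i) (p i.+1) /\
  sub_measurable_fun (@filtration_gen R T i) (p i).
Proof.
have [_ p0E hpi] := hp; split; first by have [] := hpi i.
case: i => [[|k] kT]/=.
  rewrite (_ : p 0%N = fun=> p0); last exact/funext.
  exact: measurable_cst.
have [mp _ _] := hpi (Ordinal (ltnW kT)).
exact: sub_measurable_funS (filtration_genS (leqnSn k)) mp.
Qed.

Let fm k := @filtration_gen_measurable R T k.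

Let mp k : (k <= T)%N -> measurable_fun setT (p k).
Proof.
case: k => [|k kT].
  have [_ p0E _] := hp.
  by move=> _; rewrite (_ : p 0%N = fun=> p0); [exact: measurable_cst|exact/funext].
exact: sub_measurable_funW (@fm _) (sub_p (Ordinal kT)).1.
Qed.

Let mS k : measurable_fun setT (@partial_sum R T k).
Proof. exact: sub_measurable_funW (@fm k) (@sub_measurable_partial_sum R T k). Qed.

Let mh : measurable_fun setT h.
Proof. by have [] := lipschitz1_quad_growth hL. Qed.

Let m_potential k : (k <= T)%N -> measurable_fun setT (potential k).
Proof. by move=> kT; apply: measurable_smooth_payoff => //; exact: mp. Qed.

Let m_budget (i : 'I_T) : measurable_fun setT (budget i).
Proof.
by apply: measurable_funB; apply: measurable_funX; apply: mp => //; exact: ltnW.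
Qed.

Let budget_ge0 i w : 0 <= budget i w.
Proof.
have /andP[t0 ts] := p_range i w.
by rewrite subr_ge0 ler_sqr// nnegrE ltW// p_gt0.
Qed.

Let algorithmE (i : 'I_T) w : stein_algorithm h p i w =
  smooth (stein_sol (partial_sum i w) (p i w) h) (partial_sum i w) (p i.+1 w).
Proof. by rewrite /stein_algorithm stein_solutionE. Qed.

Let m_algorithm (i : 'I_T) : measurable_fun setT (stein_algorithm h p i).
Proof.
rewrite (_ : stein_algorithm h p i = fun w => smooth
  (stein_sol (partial_sum i w) (p i w) h) (partial_sum i w) (p i.+1 w)).
  by apply: measurable_smooth_stein_sol => //; apply: mp => //; exact: ltnW.
by apply/funext => w; exact: algorithmE.
Qed.

Let sub_weight (i : 'I_T) : sub_measurable_fun (@filtration_gen R T i) (weight i).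
Proof.
rewrite /sub_measurable_fun; apply: measurable_funN.
apply: (@measurable_smooth_dstein_sol _ _ mh hL _
  (g_sigma_algebraType (@filtration_gen R T i))) => //.
- exact: sub_measurable_partial_sum.
- exact: (sub_p i).2.
- exact: (sub_p i).1.
Qed.

Let m_weight i : measurable_fun setT (weight i).
Proof. exact: sub_measurable_funW (@fm i) (@sub_weight i). Qed.

Let weight_ge0 i w : 0 <= weight i w.
Proof. by rewrite oppr_ge0; exact: smooth_dstein_sol_le0. Qed.

Let weight_le i w : weight i w <= Num.sqrt (2 / pi) / p i w.
Proof. exact: smooth_dstein_sol_ge. Qed.

(** The identity of a round taken at zero loss. It makes C_t W_t bounded, whereas for W_t alone the
    available bound is a multiple of 1 / P_{t-1}. *)
Let budget_weightE i w : budget i w * weight i w =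
  smooth h (partial_sum i w) (p i w) - smooth h (partial_sum i w) (p i.+1 w).
Proof.
have := stein_round_identity hL hsub (partial_sum i w) (p i.+1 w) (p_gt0 i w) 0.
rewrite addr0 mul0r subr0 /budget /variance_budget /weight mulrN => <-.
by rewrite opprB.
Qed.

Let absZ_ge0 : 0 <= absZ.
Proof. by apply: Rintegral_ge0. Qed.

Let smooth_p_dist (i : 'I_T) c w :
  `|smooth h c (p i w) - smooth h c (p i.+1 w)| <= p0 * absZ.
Proof.
rewrite (le_trans (smooth_dist hL _ _ _))// ler_wpM2r//.
have /andP[t0 ts] := p_range i w.
rewrite ger0_norm ?subr_ge0// (le_trans _ (p_le w (ltnW (ltn_ord i))))//.
by rewrite lerBlDr lerDl.
Qed.

Let potential_dist (i : 'I_T) w :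
  `|potential i.+1 w - potential i w| <= `|loss i w| + p0 * absZ.
Proof.
rewrite /potential partial_sumS.
rewrite (_ : _ - _ = (smooth h (partial_sum i w + loss i w) (p i.+1 w) -
    smooth h (partial_sum i w) (p i.+1 w)) +
  (smooth h (partial_sum i w) (p i.+1 w) - smooth h (partial_sum i w) (p i w))).
  rewrite (le_trans (ler_normD _ _))// lerD//; last by rewrite distrC.
  by rewrite (le_trans (smooth_lipschitz hL _ _ _))// addrAC subrr add0r.
by rewrite addrA subrK.
Qed.

(** The product C_t W_t is kept on the left so that the right-hand side is nonnegative and can be
    integrated whatever the moments of the loss. *)
Let drift_le i w : drift i w + budget i w * weight i w <=
  weight i w * loss i w ^+ 2 + cubic i w.
Proof.
have := stein_round hL hsub (partial_sum i w) (p_gt0 i w) (loss i w) (p_range i w).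
rewrite -/(weight i w) -algorithmE -partial_sumS -/(potential i.+1 w)
  -/(potential i w) -/(variance_budget p i w) -/(budget i w) -/(cubic i w).
by rewrite /drift; lra.
Qed.

Let cubic_ge0 i w : 0 <= cubic i w.
Proof. by rewrite divr_ge0 ?sqr_ge0// addr_ge0// !mulr_ge0. Qed.

Let m_cubic i : measurable_fun setT (cubic i).
Proof.
apply: measurable_funM.
  apply: measurable_funD.
    apply: measurable_funM; first exact: measurable_funM.
    by apply: (measurableT_comp (@normr_measurable _ setT)); exact: measurable_loss.
  apply: (measurableT_comp (@normr_measurable _ setT)).
  apply: measurable_funX; exact: measurable_loss.
apply: measurable_fun_inv_pos => [w|]; first by rewrite exprn_gt0.
by apply: measurable_funX; apply: mp; exact: ltnW.
Qed.

Let drift_norm_le i w : `|drift i w| <= 2 * `|loss i w| + p0 * absZ.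
Proof.
rewrite (le_trans (ler_normD _ _))// mulr2n mulrDl mul1r -addrA lerD//.
rewrite normrM algorithmE ler_piMr//.
exact: smooth_stein_sol_le1.
Qed.

Let m_drift i : measurable_fun setT (drift i).
Proof.
apply: measurable_funD; first exact: measurable_funM (measurable_loss i) (@m_algorithm i).
by apply: measurable_funB; apply: m_potential => //; exact: ltnW.
Qed.

(** From |x| <= 1 + |x|^3 and P_{t-1} <= P_0. This is how a finite error term yields integrable
    losses. *)
Let loss_le i w : `|loss i w| <= 1 + p0 ^+ 2 * cubic i w.
Proof.
set x := loss i w; have pp := p_gt0 i w.
have xc : `|x| <= 1 + `|x ^+ 3|.
  rewrite normrX exprS expr2; have := normr_ge0 x; set a := `|x|.
  have [a1|a1 a0] := leP a 1.
    by move=> a0; rewrite (le_trans a1)// lerDl !mulr_ge0.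
  by rewrite (@le_trans _ _ (a * (a * a)))// ?lerDr// ler_peMr// mulr_ege1// ltW.
rewrite (le_trans xc)// lerD2l.
apply: (@le_trans _ _ (p i w ^+ 2 * cubic i w)).
  rewrite /cubic mulrC divfK ?expf_neq0 ?gt_eqF// lerDr.
  by rewrite !mulr_ge0.
rewrite ler_wpM2r// ler_sqr ?nnegrE; [exact/p_le/ltnW|exact: ltW|].
by rewrite (le_trans (ltW pp))//; exact/p_le/ltnW.
Qed.

Let variance_error (i : 'I_T) w : \bar R :=
  ((Num.sqrt (2 / pi))%:E *
     (maxe (V i w - (budget i w)%:E) 0 * ((p i w)^-1)%:E))%E.

Let stein_errorE i w :
  stein_error p V i w = (variance_error i w + (cubic i w)%:E)%E.
Proof. by []. Qed.

Let mV i : measurable_fun setT (V i).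
Proof. by have [mVi _] := hV i; exact: sub_measurable_funW (@fm i) mVi. Qed.

Let max_ge0 (x : \bar R) : (0 <= maxe x 0)%E.
Proof. by rewrite le_max lexx orbT. Qed.

Let variance_error_ge0 i w : (0 <= variance_error i w)%E.
Proof.
by rewrite mule_ge0 ?lee_fin ?sqrtr_ge0// mule_ge0// lee_fin invr_ge0 ltW.
Qed.

Let m_variance_error i : measurable_fun setT (variance_error i).
Proof.
apply: emeasurable_funM => //; apply: emeasurable_funM.
  apply: measurable_maxe => //; apply: emeasurable_funB => //.
  exact/measurable_EFinP.
apply/measurable_EFinP; apply: measurable_fun_inv_pos => //.
by apply: mp; exact: ltnW.
Qed.

Let stein_error_ge0 i w : (0 <= stein_error p V i w)%E.
Proof. by rewrite stein_errorE adde_ge0// lee_fin. Qed.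

Let m_stein_error i : measurable_fun setT (stein_error p V i).
Proof.
apply: emeasurable_funD; first exact: m_variance_error.
by apply/measurable_EFinP; exact: m_cubic.
Qed.

(** The positive part of V is at most (V - C)^+ + C; the weight bound sqrt(2/pi) / P_{t-1} is
    applied to the first summand alone, so that the second remains exactly C W. *)
Let weight_max_le i w : ((weight i w)%:E * maxe (V i w) 0 <=
  variance_error i w + (budget i w * weight i w)%:E)%E.
Proof.
have C0 := budget_ge0 i w; have W0 := weight_ge0 i w.
apply: (@le_trans _ _ ((weight i w)%:E *
    (maxe (V i w - (budget i w)%:E) 0 + (budget i w)%:E))%E).
  rewrite lee_wpmul2l ?lee_fin//.
  rewrite ge_max; apply/andP; split; last by rewrite adde_ge0 ?lee_fin.
  by rewrite -leeBlDr// le_max lexx.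
rewrite ge0_muleDr ?lee_fin// -EFinM [(weight i w * _)%R]mulrC leeD2r//.
rewrite /variance_error muleCA muleC lee_wpmul2l// -EFinM lee_fin.
exact: weight_le.
Qed.

Let integrable_bounded (f : Omega -> R) (c : R) : measurable_fun setT f ->
  (forall w, `|f w| <= c) -> P.-integrable setT (EFin \o f).
Proof.
move=> mf fc; apply: (le_integrable measurableT _ _
    (finite_measure_integrable_cst P c measurableT)).
  exact/measurable_EFinP.
by move=> w _ /=; rewrite lee_fin (le_trans (fc w))// ler_norm.
Qed.

Hypothesis error_finite : (\int[P]_w (\sum_(i < T) stein_error p V i w) < +oo)%E.

Let integrable_cubic i : P.-integrable setT (EFin \o cubic i).
Proof.
apply/integrableP; split; first exact/measurable_EFinP.
apply: le_lt_trans error_finite; apply: ge0_le_integral => //.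
- have mc := @m_cubic i; apply: (measurableT_comp (@abse_measurable _ setT)).
  exact/measurable_EFinP.
- by apply: emeasurable_sum => i'; exact: m_stein_error.
- move=> w _; rewrite /= ger0_norm// (bigD1 i)//= stein_errorE.
  rewrite -[leLHS]add0e -[X in (X <= _)%E]adde0 leeD//.
    by rewrite leeD.
  by apply: sume_ge0.
Qed.

Let integrable_loss i : P.-integrable setT (EFin \o loss i).
Proof.
apply: (le_integrable measurableT (g := fun w => (1 + p0 ^+ 2 * cubic i w)%:E)).
- by apply/measurable_EFinP; exact: measurable_loss.
- move=> w _ /=; rewrite lee_fin (le_trans (loss_le i w))//; exact: ler_norm.
- apply: (integrableD measurableT (f := fun=> 1%:E)
    (g := fun w => ((p0 ^+ 2)%:E * (cubic i w)%:E)%E)).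
    exact: finite_measure_integrable_cst.
  exact: (integrableZl measurableT _ (@integrable_cubic i)).
Qed.

Let integrable_dominated (f : Omega -> R) i (a b : R) : measurable_fun setT f ->
  (forall w, `|f w| <= a * `|loss i w| + b) -> P.-integrable setT (EFin \o f).
Proof.
move=> mf fab; apply: (le_integrable measurableT (g := fun w => (a * `|loss i w| + b)%:E)).
- exact/measurable_EFinP.
- move=> w _ /=; rewrite lee_fin (le_trans (fab w))//; exact: ler_norm.
- apply: (integrableD measurableT (f := fun w => (a%:E * `|loss i w|%:E)%E) (g := fun=> b%:E)).
    exact: (integrableZl measurableT _ (integrable_norm (@integrable_loss i))).
  exact: finite_measure_integrable_cst.
Qed.

Let integrable_drift i : P.-integrable setT (EFin \o drift i).
Proof. exact: integrable_dominated (@m_drift i) (drift_norm_le i). Qed.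

(** The initial potential is constant, and each increment is dominated by an integrable loss plus a
    constant. *)
Let integrable_potential k : (k <= T)%N -> P.-integrable setT (EFin \o potential k).
Proof.
elim: k => [_|k ih kT].
  rewrite (_ : potential 0 = fun=> smooth h 0 p0).
    exact: finite_measure_integrable_cst.
  by apply/funext => w; rewrite /potential partial_sum0; have [_ ->] := hp.
pose i := Ordinal kT.
rewrite (_ : _ \o _ = (EFin \o potential k) \+
    (EFin \o (fun w => potential i.+1 w - potential i w)%R))%E.
  apply: integrableD => //; first exact/ih/ltnW.
  apply: (@integrable_dominated _ i 1 (p0 * absZ)).
    by apply: measurable_funB; apply: m_potential => //; exact: ltnW.
  by move=> w; rewrite mul1r; exact: potential_dist.
by apply/funext => w; rewrite /= -EFinD subrKC.
Qed.

Let integral_drift_le i :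
  (\int[P]_w (drift i w)%:E <= \int[P]_w stein_error p V i w)%E.
Proof.
have mBW : measurable_fun setT (fun w => budget i w * weight i w).
  exact: measurable_funM.
have BW0 w : 0 <= budget i w * weight i w by rewrite mulr_ge0.
have iBW : P.-integrable setT (EFin \o (fun w => budget i w * weight i w)).
  apply: (@integrable_bounded _ (p0 * absZ)) => // w.
  by rewrite budget_weightE; exact: smooth_p_dist.
have fin : (\int[P]_w (budget i w * weight i w)%:E)%E \is a fin_num.
  exact: integrable_fin_num.
(* The finite integral of C_t W_t is added to both sides: on the left it enables [drift_le], on the
   right it matches the summand produced by [weight_max_le]. *)
rewrite -(leeD2rE _ _ fin).
have -> : (\int[P]_w (drift i w)%:E + \int[P]_w (budget i w * weight i w)%:E =
    \int[P]_w (drift i w + budget i w * weight i w)%:E)%E.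
  by rewrite -integralD_EFin.
have mWG : measurable_fun setT (fun w => weight i w * loss i w ^+ 2).
  by apply: measurable_funM => //; apply: measurable_funX; exact: measurable_loss.
have WG0 w : 0 <= weight i w * loss i w ^+ 2 by rewrite mulr_ge0 ?sqr_ge0.
apply: (@le_trans _ _ (\int[P]_w (weight i w * loss i w ^+ 2 + cubic i w)%:E)%E).
  apply: le_integral_ge0r => [||w|w].
  - by apply/measurable_EFinP; exact: measurable_funD.
  - by apply/measurable_EFinP; exact: measurable_funD.
  - by rewrite lee_fin addr_ge0.
  - by rewrite lee_fin.
rewrite (_ : \int[P]_w (_ + _)%:E = \int[P]_w ((weight i w)%:E * (loss i w ^+ 2)%:E)
   + \int[P]_w (cubic i w)%:E)%E; last first.
  rewrite -ge0_integralD//.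
  - by move=> w _; rewrite lee_fin.
  - exact/measurable_EFinP.
  - by move=> w _; rewrite lee_fin.
  - exact/measurable_EFinP.
have -> : (\int[P]_w stein_error p V i w = \int[P]_w variance_error i w +
    \int[P]_w (cubic i w)%:E)%E.
  rewrite -ge0_integralD//; first by move=> w _; rewrite lee_fin.
  exact/measurable_EFinP.

have leAC (a b c e : \bar R) : (a <= b + c -> a + e <= b + e + c)%E.
  by move=> abc; rewrite addeAC; exact: leeD.
apply: leAC.
have mG2 : measurable_fun setT (fun w : Omega => loss i w ^+ 2).
  by apply: measurable_funX; exact: measurable_loss.
have ce := cond_expectation_le (@fm i) (fun w => sqr_ge0 (loss i w)) mG2 (hV i)
  (@sub_weight i) (weight_ge0 i).
apply: (le_trans ce).
rewrite -ge0_integralD//; [|by move=> w _; rewrite lee_fin|exact/measurable_EFinP].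
apply: ge0_le_integral => //.
- by move=> w _; rewrite mule_ge0// lee_fin.
- apply: emeasurable_funM; first exact/measurable_EFinP.
  exact: measurable_maxe.
- by apply: emeasurable_funD => //; exact/measurable_EFinP.
Qed.

(** Exhibiting the terms on the right as reals makes the extended addition of the final statement
    coincide with the real one. *)
Lemma stein_regret_bound : exists r e : R,
  [/\ (\int[P]_w (smooth h (partial_sum T w) (p T w))%:E = r%:E)%E,
      (\int[P]_w (\sum_(i < T) stein_error p V i w) = e%:E)%E &
      (\int[P]_w (\sum_(i < T) loss i w * stein_algorithm h p i w)%:E <=
       (- r + smooth h 0 p0 + e)%:E)%E].
Proof.
have ipT : P.-integrable setT (EFin \o potential T) by exact: integrable_potential.
have finT : (\int[P]_w (potential T w)%:E)%E \is a fin_num.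
  exact: integrable_fin_num.
have fine_err : (\int[P]_w (\sum_(i < T) stein_error p V i w))%E \is a fin_num.
  by rewrite ge0_fin_numE// integral_ge0// => w _; apply: sume_ge0.
exists (fine (\int[P]_w (potential T w)%:E)).
exists (fine (\int[P]_w (\sum_(i < T) stein_error p V i w)))%E.
split; rewrite ?fineK// !EFinD EFinN (fineK finT) (fineK fine_err).
have telescope (w : Omega) : \sum_(i < T) loss i w * stein_algorithm h p i w =
    \sum_(i < T) drift i w + (smooth h 0 p0 - potential T w).
  have -> : smooth h 0 p0 = potential 0 w.
    by rewrite /potential partial_sum0; have [_ ->] := hp.
  rewrite -opprB -(telescope_sumr (fun k => potential k w) (leq0n T)) big_mkord.
  by rewrite -sumrB; apply: eq_bigr => i _; rewrite /drift addrK.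
have isum : P.-integrable setT (fun w => \sum_(i < T) (drift i w)%:E)%E.
  by apply: (integrable_sum measurableT) => i _; exact: (@integrable_drift i).
have ic : P.-integrable setT (EFin \o (fun=> smooth h 0 p0)).
  exact: finite_measure_integrable_cst.
have -> : (\int[P]_w (\sum_(i < T) loss i w * stein_algorithm h p i w)%:E =
    \int[P]_w (\sum_(i < T) (drift i w)%:E + (smooth h 0 p0 - potential T w)%:E))%E.
  by apply: eq_integral => w _; rewrite telescope EFinD sumEFin.
have icT : P.-integrable setT (fun w => (smooth h 0 p0 - potential T w)%:E).
  exact: (integrableB measurableT ic ipT).
rewrite integralD//.
have -> : (\int[P]_w (smooth h 0 p0 - potential T w)%:E =
    - (\int[P]_w (potential T w)%:E) + (smooth h 0 p0)%:E)%E.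
  rewrite (integralB_EFin measurableT ic ipT) [LHS]addeC; congr adde.
  by rewrite [LHS]integral_cst// [X in (_ * X)%E]probability_setT mule1.
have le_err : (\int[P]_w (\sum_(i < T) (drift i w)%:E) <=
    \int[P]_w (\sum_(i < T) stein_error p V i w))%E.
  rewrite integral_sum//.
  rewrite ge0_integral_sum//.
  by apply: lee_sum => i _; exact: integral_drift_le.
have leC (a b c e : \bar R) : (a <= b -> a + (c + e) <= c + e + b)%E.
  by move=> ab; rewrite addeC; exact: leeD.
exact: leC.
Qed.

End stein_regret.

(* The three terms on the right are added with the convention
   +oo + -oo = +oo.  The convention is used only when some loss is not
   P-integrable; the error term is then +oo and nothing is claimed. *)
Theorem theorem6 (R : realType) (T : nat) (hT : (1 <= T)%N)
  (h : R -> R) (h_convex : convex_function [set: R^o] h)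
  (h_lipschitz : 1.-lipschitz (h : R^o -> R^o))
  (p0 : R) (p : nat -> loss_space R T -> R) (hp : admissible p0 p)
  (P : probability (loss_space R T) R)
  (V : 'I_T -> loss_space R T -> \bar R)
  (hV : forall i : 'I_T,
     is_cond_expectation P (@filtration_gen R T i)
       (fun w => loss i w ^+ 2) (V i)) :
  ('E_P[fun w => (\sum_(i < T) loss i w * stein_algorithm h p i w)%R]%E <=
   - 'E_P[fun w => gaussian_expectation
            (fun z => h (\sum_(i < T) loss i w + p T w * z)%R)]%E
   + (gaussian_expectation (fun z => h (p0 * z)%R))%:E
   + (\int[P]_w (\sum_(i < T) stein_error p V i w))%E)%dE.
Proof.
have hL x y : `|h x - h y| <= `|x - y|.
  by have /= := h_lipschitz (x, y) (conj Logic.I Logic.I); rewrite mul1r.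
have hsub := convex_subgradient h_convex.
have [err_oo|] := leP +oo%E (\int[P]_w (\sum_(i < T) stein_error p V i w))%E.
  move: err_oo; rewrite leye_eq => /eqP ->.
  by case: (- _ + _)%dE => [r| |]; rewrite leey.
move=> /(stein_regret_bound hL hsub hp hV)[r [e [rE eE bound]]].
rewrite unlock eE.
have -> : (\int[P]_w (gaussian_expectation
    (fun z => h (\sum_(i < T) loss i w + p T w * z)%R))%:E = r%:E)%E.
  by rewrite -rE; apply: eq_integral => w _; rewrite partial_sumT.
have -> : gaussian_expectation (fun z => h (p0 * z)) = smooth h 0 p0.
  by congr gaussian_expectation; apply/funext => z; rewrite add0r.
exact: bound.
Qed.
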